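(* Let $\mathcal{C}$ be a category with local products, and let $\mathcal{M}_0,\mathcal{M}_1,\mathcal{M}_2$ be the classes of spans defined in the context. For a class $\mathcal{M}$ of spans, let (c1)–(c11) be the conditions on $(\mathcal{C},\mathcal{M})$ listed in the context. (1) $\mathcal{C}$ is of naturally Mal'tsev type if and only if the (mutually equivalent) conditions (c1)–(c11) hold for $\mathcal{M}=\mathcal{M}_0$. Moreover, in this case, assuming the existence of binary products and a terminal object, each object $D$ of $\mathcal{C}$ admits a canonical Mal'tsev operation (a morphism $p_D\colon D\times D\times D\to D$, natural in $D$, with $p_D\langle x,y,y\rangle=x$ and $p_D\langle x,x,y\rangle=y$ for all $x,y\colon Z\to D$). Furthermore, in this case, if pushouts of split monomorphisms along split monomorphisms exist in $\mathcal{C}$, then every local product is also a local coproduct. (2) $\mathcal{C}$ is of Mal'tsev type if and only if the (mutually equivalent) conditions (c1)–(c11) hold for $\mathcal{M}=\mathcal{M}_1$. Moreover, these conditions are further equivalent to the requirement that every local product in $\mathcal{C}$ is extremal. (3) Assume that $\mathcal{C}$ has equalizers, and that kernel pairs exist for every composite $pk$ of a split epimorphism $p\colon E\to A$ with an equalizer $k\colon D\to E$. Then $\mathcal{C}$ is of weakly Mal'tsev type if and only if the (mutually equivalent) conditions (c1)–(c11) hold for $\mathcal{M}=\mathcal{M}_2$.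
   Context: **Local products.** A category $\mathcal{C}$ has local products if for all $f\colon A\to B$, $r\colon B\to A$, $g\colon C\to B$, $s\colon B\to C$ with $fr=1_B=gs$, the pullback of $g$ along $f$ exists; it comes with a chosen (canonical) pullback $(A\times_BC,\pi_1,\pi_2)$ (so $f\pi_1=g\pi_2$) and the induced $e_1=\langle 1_A,sf\rangle$, $e_2=\langle rg,1_C\rangle$. A local product is a diagram $p_1\colon E\to A$, $e_1\colon A\to E$, $p_2\colon E\to C$, $e_2\colon C\to E$ for which there exist such $f,r,g,s$ with $(E,p_1,p_2)$ the pullback of $g$ along $f$ and $e_1=\langle 1_A,sf\rangle$, $e_2=\langle rg,1_C\rangle$. It is a *local coproduct* if, moreover, $(e_1,e_2)$ is the pushout of the span $r\colon B\to A$, $s\colon B\to C$. **Classes of spans.** A span $(D,d,c)$ is a pair $d\colon D\to D_0$, $c\colon D\to D_1$. - $\mathcal{M}_0$: all spans $(D,d,c)$ such that the kernel pairs of $d$ and $c$ exist. - $\mathcal{M}_1$: those in $\mathcal{M}_0$ with $(d,c)$ jointly monic. - $\mathcal{M}_2$: those in $\mathcal{M}_0$ with $(d,c)$ jointly strongly monic. Here $(d,c)$ is jointly strongly monic if, in the presence of binary products, $\langle d,c\rangle\colon D\to D_0\times D_1$ is a strong monomorphism, that is, it is orthogonal to the class of all epimorphisms: for every epimorphism $q\colon X\to Y$ and all $u\colon X\to D$, $g\colon Y\to D_0\times D_1$ with $\langle d,c\rangle u=gq$, there is a unique $m\colon Y\to D$ with $mq=u$ and $\langle d,c\rangle m=g$.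 (Written componentwise, with $g=\langle g_0,g_1\rangle$: whenever $q$ is an epimorphism, $du=g_0q$ and $cu=g_1q$, there is a unique $m\colon Y\to D$ with $mq=u$, $dm=g_0$, $cm=g_1$.) **Mal'tsev-type notions.** - $\mathcal{C}$ is of *naturally Mal'tsev type* if the Lawvere Condition holds: the forgetful functor from internal groupoids to reflexive graphs in $\mathcal{C}$ is an isomorphism of categories (every reflexive graph has a unique groupoid structure). - $\mathcal{C}$ is of *Mal'tsev type* if every reflexive relation is a tolerance relation, i.e. reflexive and symmetric: for every reflexive graph $(C_1,C_0,d,e,c)$ with $(d,c)$ jointly monic there is $i\colon C_1\to C_1$ with $di=c$, $ci=d$. - $\mathcal{C}$ is of *weakly Mal'tsev type* if in every local product $(E,p_1,p_2,e_1,e_2)$ the pair $(e_1,e_2)$ is jointly epimorphic. A local product $(E,p_1,p_2,e_1,e_2)$ is *extremal* if for every span $(D,d,c)\in\mathcal{M}_1$ and all $\alpha\colon A\to D$, $\gamma\colon C\to D$ with $d\alpha=d\gamma p_2e_1$ and $c\gamma=c\alpha p_1e_2$, there is a unique $m\colon E\to D$ with $dm=d\gamma p_2$, $cm=c\alpha p_1$, $me_1=\alpha$, $me_2=\gamma$. **Internal structures.** For a class $\mathcal{M}$ of spans whose legs have kernel pairs: $\mathbf{Span}(\mathcal{C},\mathcal{M})$: spans in $\mathcal{M}$, with morphisms $(D,d,c)\to(D',d',c')$ the triples $h_D\colon D\to D'$, $h_0\colon D_0\to D_0'$, $h_1\colon D_1\to D_1'$ with $d'h_D=h_0d$, $c'h_D=h_1c$.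 $\mathbf{RG}(\mathcal{C})$: reflexive graphs $(C_1,C_0,d,e,c)$ with $d,c\colon C_1\to C_0$, $e\colon C_0\to C_1$, $de=1_{C_0}=ce$; morphisms $(f_1,f_0)$ with $d'f_1=f_0d$, $c'f_1=f_0c$, $f_1e=e'f_0$. Let $(C_2,\pi_1,\pi_2)$ be the chosen pullback with $d\pi_1=c\pi_2$, $e_1=\langle 1_{C_1},ed\rangle$, $e_2=\langle ec,1_{C_1}\rangle$. $\mathbf{UMG}(\mathcal{C})$ (unital multiplicative graphs): reflexive graphs with $m\colon C_2\to C_1$, $dm=d\pi_2$, $cm=c\pi_1$, $me_1=1_{C_1}=me_2$; morphisms are those of reflexive graphs with $f_1m=m'(f_1\times_{f_0}f_1)$. $\mathbf{Cat}(\mathcal{C})$: those with $m$ associative ($m\langle m\langle x,y\rangle,z\rangle=m\langle x,m\langle y,z\rangle\rangle$ for all $x,y,z\colon Z\to C_1$ with $dx=cy$, $dy=cz$). $\mathbf{Grpd}(\mathcal{C})$: internal categories with inverses (there is $i\colon C_1\to C_1$ with $di=c$, $ci=d$, $m\langle 1_{C_1},i\rangle=ec$, $m\langle i,1_{C_1}\rangle=ed$). $\mathbf{X}(\mathcal{C},\mathcal{M})$, for $\mathbf{X}\in\{\mathbf{RG},\mathbf{UMG},\mathbf{Cat},\mathbf{Grpd}\}$, is the full subcategory of objects with $(C_1,d,c)\in\mathcal{M}$. Pregroupoids: for a span $(D,d,c)$ whose legs have kernel pairs, let $D(d,c)$ be the object (which exists by local products) such that morphisms $Z\to D(d,c)$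 correspond to triples $\langle x,y,z\rangle$ of morphisms $Z\to D$ with $dx=dy$, $cy=cz$; $\mathrm{dom},\mathrm{cod}\colon D(d,c)\to D$ are the first and third projections. A pregroupoid structure is $p\colon D(d,c)\to D$ with $p\langle x,y,y\rangle=x$ (if $dx=dy$), $p\langle y,y,z\rangle=z$ (if $cy=cz$), $dp=d\,\mathrm{cod}$, $cp=c\,\mathrm{dom}$. $\mathbf{PreGrpd}(\mathcal{C},\mathcal{M})$: spans in $\mathcal{M}$ with a pregroupoid structure; morphisms are span morphisms compatible with it. Directed kites: $f\colon A\to B$, $r\colon B\to A$, $g\colon C\to B$, $s\colon B\to C$, $\alpha\colon A\to D$, $\beta\colon B\to D$, $\gamma\colon C\to D$ with $fr=1_B=gs$, $\alpha r=\beta=\gamma s$, and a span $(D,d,c)$ with $d\alpha=d\beta f$, $c\beta g=c\gamma$. $\mathbf{DiKite}(\mathcal{C},\mathcal{M})$: directed kites with $(D,d,c)\in\mathcal{M}$ and natural transformations of such diagrams (components $h_A,h_B,h_C,h_D,h_0,h_1$). A multiplication is $m\colon A\times_BC\to D$ with $dm=d\gamma\pi_2$, $cm=c\alpha\pi_1$, $me_1=\alpha$, $me_2=\gamma$. $\mathbf{MKite}(\mathcal{C},\mathcal{M})$: directed kites with multiplication, morphisms satisfying $h_Dm=m'(h_A\times_{h_B}h_C)$. **Conditions** (all functors are the forgetful ones; a section of $F$ is a functor $S$ with $FS=\mathrm{Id}$): (c1) $\mathbf{Grpd}(\mathcal{C},\mathcal{M})\to\mathbf{RG}(\mathcal{C},\mathcal{M})$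 is an isomorphism of categories; (c2) it has a section; (c3) $\mathbf{Cat}(\mathcal{C},\mathcal{M})\to\mathbf{RG}(\mathcal{C},\mathcal{M})$ is an isomorphism; (c4) it has a section; (c5) $\mathbf{UMG}(\mathcal{C},\mathcal{M})\to\mathbf{RG}(\mathcal{C},\mathcal{M})$ is an isomorphism; (c6) it has a section; (c7) $\mathbf{PreGrpd}(\mathcal{C},\mathcal{M})\to\mathbf{Span}(\mathcal{C},\mathcal{M})$ is an isomorphism; (c8) it has a section; (c9) $\mathbf{MKite}(\mathcal{C},\mathcal{M})\to\mathbf{DiKite}(\mathcal{C},\mathcal{M})$ is an isomorphism; (c10) it has a section; (c11) for all $p_1\colon E\to A$, $e_1\colon A\to E$, $p_2\colon E\to C$, $e_2\colon C\to E$, $\alpha\colon A\to D$, $\beta\colon E\to D$, $\gamma\colon C\to D$, $d\colon D\to D_0$, $c\colon D\to D_1$ with $(p_1,p_2)$ jointly monic, $(D,d,c),(E,p_1,p_2)\in\mathcal{M}$, $p_1e_1=1_A$, $p_2e_2=1_C$, $e_1p_1e_2p_2=e_2p_2e_1p_1$, $\alpha p_1e_2p_2=\beta=\gamma p_2e_1p_1$, $d\alpha p_1=d\alpha p_1e_2p_2$, $c\gamma p_2=c\gamma p_2e_1p_1$, there is a unique $m\colon E\to D$ with $me_1=\alpha$, $me_2=\gamma$, $dm=d\gamma p_2$, $cm=c\alpha p_1$. *)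

(* Defs.v *)
From Stdlib Require Import IndefiniteDescription ProofIrrelevance.

Set Implicit Arguments.
Unset Strict Implicit.
Unset Printing Implicit Defensive.

Declare Scope cat_scope.
Delimit Scope cat_scope with cat.

Record Category : Type := {
  Ob :> Type;
  Hom : Ob -> Ob -> Type;
  idm : forall A : Ob, Hom A A;
  comp : forall A B C : Ob, Hom B C -> Hom A B -> Hom A C;
  comp_idl : forall (A B : Ob) (f : Hom A B), comp (idm B) f = f;
  comp_idr : forall (A B : Ob) (f : Hom A B), comp f (idm A) = f;
  comp_assoc : forall (A B C D : Ob) (h : Hom C D) (g : Hom B C) (f : Hom A B),
    comp h (comp g f) = comp (comp h g) f
}.

Arguments Hom {_} _ _.
Arguments idm {_} _.
Arguments comp {_ _ _ _} _ _.
Arguments comp_idl {_ _ _} _.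
Arguments comp_idr {_ _ _} _.
Arguments comp_assoc {_ _ _ _ _} _ _ _.

Notation "A ~> B" := (Hom A B) (at level 70, no associativity) : cat_scope.
Notation "g ∘ f" := (comp g f) (at level 40, left associativity) : cat_scope.
Notation "'id_' A" := (idm A) (at level 10, A at level 9) : cat_scope.
Open Scope cat_scope.

Record Functor (X Y : Category) : Type := {
  fob :> X -> Y;
  fmor : forall A B : X, A ~> B -> fob A ~> fob B;
  fmor_id : forall A : X, fmor (id_ A) = id_ (fob A);
  fmor_comp : forall (A B C : X) (g : B ~> C) (f : A ~> B),
    fmor (g ∘ f) = fmor g ∘ fmor f
}.

Arguments fmor {_ _} _ {_ _} _.

Definition idF (X : Category) : Functor X X.
Proof.
  refine {| fob := fun A : X => A; fmor := fun A B f => f |}; reflexivity.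
Defined.

Definition compF (X Y Z : Category) (G : Functor Y Z) (F : Functor X Y) :
  Functor X Z.
Proof.
  refine {| fob := fun A => G (F A); fmor := fun A B f => fmor G (fmor F f) |}.
  - intros A; now rewrite !fmor_id.
  - intros A B C g f; now rewrite !fmor_comp.
Defined.

Definition IsIsomorphism (X Y : Category) (F : Functor X Y) : Prop :=
  exists G : Functor Y X, compF F G = idF Y /\ compF G F = idF X.

Definition HasSection (X Y : Category) (F : Functor X Y) : Prop :=
  exists S : Functor Y X, compF F S = idF Y.

Record SubOb (X : Category) (P : X -> Prop) : Type := {
  sub_ob : X;
  sub_in : P sub_ob
}.

Arguments sub_ob {_ _} _.
Arguments sub_in {_ _} _.

Definition FullSub (X : Category) (P : X -> Prop) : Category.
Proof.
  refine {| Ob := SubOb P;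
            Hom := fun A B => sub_ob A ~> sub_ob B;
            idm := fun A => id_ (sub_ob A);
            comp := fun A B C g f => g ∘ f |}.
  - intros A B f; apply comp_idl.
  - intros A B f; apply comp_idr.
  - intros A B C D h g f; apply comp_assoc.
Defined.

Definition inclF (X : Category) (P : X -> Prop) : Functor (FullSub P) X.
Proof.
  refine {| fob := fun A : FullSub P => sub_ob A; fmor := fun A B f => f |};
    reflexivity.
Defined.

Definition restrictF (X Y : Category) (F : Functor X Y) (P : Y -> Prop) :
  Functor (FullSub (fun A : X => P (F A))) (FullSub P).
Proof.
  refine (@Build_Functor (FullSub (fun A : X => P (F A))) (FullSub P)
            (fun A => {| sub_ob := F (sub_ob A); sub_in := sub_in A |})
            (fun A B f => fmor F f) _ _).
  - intros A; exact (fmor_id F (sub_ob A)).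
  - intros A B C g f; exact (fmor_comp F g f).
Defined.

(** A family of structures on the objects of a category, together with a notion
    of structure-preserving morphism, yields the category of structured
    objects and its forgetful functor. *)

Record Structure (X : Category) : Type := {
  str : X -> Type;
  pres : forall A B : X, str A -> str B -> A ~> B -> Prop;
  pres_id : forall (A : X) (s : str A), pres s s (id_ A);
  pres_comp : forall (A B C : X) (s : str A) (t : str B) (u : str C)
    (g : B ~> C) (f : A ~> B), pres t u g -> pres s t f -> pres s u (g ∘ f)
}.

Record StrOb (X : Category) (T : Structure X) : Type := {
  under : X;
  the_str : str T under
}.

Record StrHom (X : Category) (T : Structure X) (A B : StrOb T) : Type := {
  under_mor : under A ~> under B;
  under_pres : pres (the_str A) (the_str B) under_mor
}.

Lemma StrHom_eq (X : Category) (T : Structure X) (A B : StrOb T)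
  (f g : StrHom A B) : under_mor f = under_mor g -> f = g.
Proof.
  destruct f as [f pf], g as [g pg]; simpl; intros e; subst g.
  now rewrite (proof_irrelevance _ pf pg).
Qed.

Definition Structured (X : Category) (T : Structure X) : Category.
Proof.
  refine {| Ob := StrOb T;
            Hom := @StrHom X T;
            idm := fun A => {| under_mor := id_ (under A);
                               under_pres := pres_id (the_str A) |};
            comp := fun A B C g f =>
              {| under_mor := under_mor g ∘ under_mor f;
                 under_pres := pres_comp (under_pres g) (under_pres f) |} |}.
  - intros A B f; apply StrHom_eq, comp_idl.
  - intros A B f; apply StrHom_eq, comp_idr.
  - intros A B C D h g f; apply StrHom_eq, comp_assoc.
Defined.

Definition forgetF (X : Category) (T : Structure X) :
  Functor (Structured T) X.
Proof.
  refine (@Build_Functor (Structured T) X (@under X T)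
            (fun A B f => under_mor f) _ _); reflexivity.
Defined.

Section Limits.
Context {CC : Category}.

Definition IsEpi {A B : CC} (q : A ~> B) : Prop :=
  forall (Z : CC) (u v : B ~> Z), u ∘ q = v ∘ q -> u = v.

Definition IsSplitEpi {A B : CC} (p : A ~> B) : Prop :=
  exists s : B ~> A, p ∘ s = id_ B.

Definition IsSplitMono {A B : CC} (k : A ~> B) : Prop :=
  exists r : B ~> A, r ∘ k = id_ A.

Definition JointlyMonic {D X Y : CC} (d : D ~> X) (c : D ~> Y) : Prop :=
  forall (Z : CC) (u v : Z ~> D), d ∘ u = d ∘ v -> c ∘ u = c ∘ v -> u = v.

Definition JointlyEpic {X Y E : CC} (e1 : X ~> E) (e2 : Y ~> E) : Prop :=
  forall (Z : CC) (u v : E ~> Z), u ∘ e1 = v ∘ e1 -> u ∘ e2 = v ∘ e2 -> u = v.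

(** Orthogonality of [<d, c>] to all epimorphisms, written componentwise so that
    the product of [X] and [Y] need not exist. *)
Definition JointlyStronglyMonic {D X Y : CC} (d : D ~> X) (c : D ~> Y) : Prop :=
  forall (Z W : CC) (q : Z ~> W), IsEpi q ->
  forall (u : Z ~> D) (g0 : W ~> X) (g1 : W ~> Y),
    d ∘ u = g0 ∘ q -> c ∘ u = g1 ∘ q ->
    exists! m : W ~> D, m ∘ q = u /\ d ∘ m = g0 /\ c ∘ m = g1.

Record IsPullback {A B C E : CC} (f : A ~> B) (g : C ~> B)
    (p1 : E ~> A) (p2 : E ~> C) : Prop := {
  pb_comm : f ∘ p1 = g ∘ p2;
  pb_univ : forall (Z : CC) (x : Z ~> A) (y : Z ~> C), f ∘ x = g ∘ y ->
    exists! m : Z ~> E, p1 ∘ m = x /\ p2 ∘ m = y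
}.

Record Pullback {A B C : CC} (f : A ~> B) (g : C ~> B) : Type := {
  pb_ob : CC;
  pb_1 : pb_ob ~> A;
  pb_2 : pb_ob ~> C;
  pb_is : IsPullback f g pb_1 pb_2
}.

Definition HasKernelPair {A B : CC} (f : A ~> B) : Prop :=
  inhabited (Pullback f f).

Definition IsPushout {B A C Q : CC} (r : B ~> A) (s : B ~> C)
    (i1 : A ~> Q) (i2 : C ~> Q) : Prop :=
  i1 ∘ r = i2 ∘ s /\
  forall (Z : CC) (x : A ~> Z) (y : C ~> Z), x ∘ r = y ∘ s ->
    exists! m : Q ~> Z, m ∘ i1 = x /\ m ∘ i2 = y.

Definition IsEqualizer {D E W : CC} (k : D ~> E) (u v : E ~> W) : Prop :=
  u ∘ k = v ∘ k /\
  forall (Z : CC) (x : Z ~> E), u ∘ x = v ∘ x -> exists! m : Z ~> D, k ∘ m = x.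

Section Pair.
Context {A B C E : CC} {f : A ~> B} {g : C ~> B} {p1 : E ~> A} {p2 : E ~> C}
  (H : IsPullback f g p1 p2).

Definition pair {Z : CC} (x : Z ~> A) (y : Z ~> C) (e : f ∘ x = g ∘ y) : Z ~> E :=
  proj1_sig (constructive_indefinite_description _ (pb_univ H e)).

Lemma pair_1 {Z : CC} (x : Z ~> A) (y : Z ~> C) (e : f ∘ x = g ∘ y) :
  p1 ∘ pair e = x.
Proof.
  unfold pair.
  destruct constructive_indefinite_description as [m [[h1 h2] hu]]; exact h1.
Qed.

Lemma pair_2 {Z : CC} (x : Z ~> A) (y : Z ~> C) (e : f ∘ x = g ∘ y) :
  p2 ∘ pair e = y.
Proof.
  unfold pair.
  destruct constructive_indefinite_description as [m [[h1 h2] hu]]; exact h2.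
Qed.

Lemma pb_joint : JointlyMonic p1 p2.
Proof.
  intros Z u v e1 e2.
  assert (e : f ∘ (p1 ∘ v) = g ∘ (p2 ∘ v))
    by now rewrite !comp_assoc, (pb_comm H).
  destruct (pb_univ H e) as [m [_ hu]].
  rewrite <- (hu u (conj e1 e2)).
  now apply hu.
Qed.
End Pair.

End Limits.

Definition HasTerminal (CC : Category) : Prop :=
  exists T : CC, forall Z : CC, exists! m : Z ~> T, True.

Definition HasEqualizers (CC : Category) : Prop :=
  forall (E W : CC) (u v : E ~> W),
    exists (D : CC) (k : D ~> E), IsEqualizer k u v.

Definition HasSplitMonoPushouts (CC : Category) : Prop :=
  forall (B A C : CC) (r : B ~> A) (s : B ~> C),
    IsSplitMono r -> IsSplitMono s ->
    exists (Q : CC) (i1 : A ~> Q) (i2 : C ~> Q), IsPushout r s i1 i2.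

Definition HasSplitEpiEqualizerKernelPairs (CC : Category) : Prop :=
  forall (D E A : CC) (k : D ~> E) (p : E ~> A),
    (exists (W : CC) (u v : E ~> W), IsEqualizer k u v) -> IsSplitEpi p ->
    HasKernelPair (p ∘ k).

Record BinaryProducts (CC : Category) : Type := {
  prod_ob : CC -> CC -> CC;
  prod_1 : forall A B : CC, prod_ob A B ~> A;
  prod_2 : forall A B : CC, prod_ob A B ~> B;
  prod_univ : forall (A B Z : CC) (x : Z ~> A) (y : Z ~> B),
    exists! m : Z ~> prod_ob A B, prod_1 A B ∘ m = x /\ prod_2 A B ∘ m = y
}.

Section Cube.
Context {CC : Category} (BP : BinaryProducts CC).

Definition prod_pair {A B Z : CC} (x : Z ~> A) (y : Z ~> B) : Z ~> prod_ob BP A B :=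
  proj1_sig (constructive_indefinite_description _ (prod_univ BP x y)).

Definition cube (D : CC) : CC := prod_ob BP (prod_ob BP D D) D.

Definition cube_triple {D Z : CC} (x y z : Z ~> D) : Z ~> cube D :=
  prod_pair (prod_pair x y) z.

Definition cube_map {D D' : CC} (h : D ~> D') : cube D ~> cube D' :=
  let q1 := prod_1 BP (prod_ob BP D D) D in
  let q2 := prod_2 BP (prod_ob BP D D) D in
  cube_triple (h ∘ (prod_1 BP D D ∘ q1)) (h ∘ (prod_2 BP D D ∘ q1)) (h ∘ q2).

Definition IsNaturalMaltsevOperation (p : forall D : CC, cube D ~> D) : Prop :=
  (forall (D D' : CC) (h : D ~> D'), h ∘ p D = p D' ∘ cube_map h) /\
  (forall (D Z : CC) (x y : Z ~> D),
     p D ∘ cube_triple x y y = x /\ p D ∘ cube_triple x x y = y).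
End Cube.

Record SplitCospan {CC : Category} (A B C : CC) : Type := {
  sc_f : A ~> B;
  sc_r : B ~> A;
  sc_g : C ~> B;
  sc_s : B ~> C;
  sc_fr : sc_f ∘ sc_r = id_ B;
  sc_gs : sc_g ∘ sc_s = id_ B
}.

(** The chosen pullback may depend on the splittings [r] and [s], not only on
    [f] and [g]. *)
Definition LocalProducts (CC : Category) : Type :=
  forall (A B C : CC) (S : SplitCospan A B C), Pullback (sc_f S) (sc_g S).

Section LocalProductDiagrams.
Context {CC : Category}.

(** The last four equations say [e1 = <1, sf>] and [e2 = <rg, 1>]. *)
Definition IsLocalProductOf {A B C E : CC} (S : SplitCospan A B C)
    (p1 : E ~> A) (e1 : A ~> E) (p2 : E ~> C) (e2 : C ~> E) : Prop :=
  IsPullback (sc_f S) (sc_g S) p1 p2 /\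
  p1 ∘ e1 = id_ A /\ p2 ∘ e1 = sc_s S ∘ sc_f S /\
  p1 ∘ e2 = sc_r S ∘ sc_g S /\ p2 ∘ e2 = id_ C.

Definition IsLocalProduct {A C E : CC}
    (p1 : E ~> A) (e1 : A ~> E) (p2 : E ~> C) (e2 : C ~> E) : Prop :=
  exists (B : CC) (S : SplitCospan A B C), IsLocalProductOf S p1 e1 p2 e2.

(** The witnesses [B, f, r, g, s] of a local product are unique up to an
    isomorphism of [B], so it does not matter which ones are used here. *)
Definition IsLocalCoproduct {A C E : CC}
    (p1 : E ~> A) (e1 : A ~> E) (p2 : E ~> C) (e2 : C ~> E) : Prop :=
  exists (B : CC) (S : SplitCospan A B C),
    IsLocalProductOf S p1 e1 p2 e2 /\ IsPushout (sc_r S) (sc_s S) e1 e2.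
End LocalProductDiagrams.

Section ChosenLocalProducts.
Context {CC : Category} (LP : LocalProducts CC).

Section One.
Context {A B C : CC} (S : SplitCospan A B C).

Definition lp : CC := pb_ob (LP S).
Definition lp_1 : lp ~> A := pb_1 (LP S).
Definition lp_2 : lp ~> C := pb_2 (LP S).
Definition lp_is : IsPullback (sc_f S) (sc_g S) lp_1 lp_2 := pb_is (LP S).

Definition lp_pair {Z : CC} (x : Z ~> A) (y : Z ~> C)
    (e : sc_f S ∘ x = sc_g S ∘ y) : Z ~> lp :=
  pair lp_is e.

Lemma lp_e1_eq : sc_f S ∘ id_ A = sc_g S ∘ (sc_s S ∘ sc_f S).
Proof. now rewrite comp_assoc, sc_gs, comp_idl, comp_idr. Qed.

Lemma lp_e2_eq : sc_f S ∘ (sc_r S ∘ sc_g S) = sc_g S ∘ id_ C.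
Proof. now rewrite comp_assoc, sc_fr, comp_idl, comp_idr. Qed.

Definition lp_e1 : A ~> lp := lp_pair lp_e1_eq.
Definition lp_e2 : C ~> lp := lp_pair lp_e2_eq.
End One.

Section Map.
Context {A B C A' B' C' : CC} {S : SplitCospan A B C} {S' : SplitCospan A' B' C'}
  {hA : A ~> A'} {hB : B ~> B'} {hC : C ~> C'}
  (ef : sc_f S' ∘ hA = hB ∘ sc_f S) (eg : sc_g S' ∘ hC = hB ∘ sc_g S).

Lemma lp_map_eq : sc_f S' ∘ (hA ∘ lp_1 S) = sc_g S' ∘ (hC ∘ lp_2 S).
Proof.
  rewrite !comp_assoc, ef, eg, <- !comp_assoc.
  now rewrite (pb_comm (lp_is S)).
Qed.

Definition lp_map : lp S ~> lp S' := lp_pair lp_map_eq.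

Lemma lp_map_1 : lp_1 S' ∘ lp_map = hA ∘ lp_1 S.
Proof. apply pair_1. Qed.

Lemma lp_map_2 : lp_2 S' ∘ lp_map = hC ∘ lp_2 S.
Proof. apply pair_2. Qed.
End Map.
End ChosenLocalProducts.

Record SpanOb (CC : Category) : Type := {
  sp_D : CC;
  sp_D0 : CC;
  sp_D1 : CC;
  sp_d : sp_D ~> sp_D0;
  sp_c : sp_D ~> sp_D1
}.

Record SpanHom (CC : Category) (S T : SpanOb CC) : Type := {
  sh_D : sp_D S ~> sp_D T;
  sh_0 : sp_D0 S ~> sp_D0 T;
  sh_1 : sp_D1 S ~> sp_D1 T;
  sh_d : sp_d T ∘ sh_D = sh_0 ∘ sp_d S;
  sh_c : sp_c T ∘ sh_D = sh_1 ∘ sp_c S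
}.

Lemma SpanHom_eq (CC : Category) (S T : SpanOb CC) (h k : SpanHom S T) :
  sh_D h = sh_D k -> sh_0 h = sh_0 k -> sh_1 h = sh_1 k -> h = k.
Proof.
  destruct h as [a b c p q], k as [a' b' c' p' q']; simpl.
  intros; subst a' b' c'.
  now rewrite (proof_irrelevance _ p p'), (proof_irrelevance _ q q').
Qed.

Lemma square_id (CC : Category) (A B : CC) (f : A ~> B) : f ∘ id_ A = id_ B ∘ f.
Proof. now rewrite comp_idl, comp_idr. Qed.

Lemma square_comp (CC : Category) (A B A' B' A'' B'' : CC)
  (f : A ~> B) (f' : A' ~> B') (f'' : A'' ~> B'')
  (h : A ~> A') (k : B ~> B') (h' : A' ~> A'') (k' : B' ~> B'') :
  f'' ∘ h' = k' ∘ f' -> f' ∘ h = k ∘ f -> f'' ∘ (h' ∘ h) = (k' ∘ k) ∘ f.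
Proof.
  intros e' e.
  now rewrite comp_assoc, e', <- comp_assoc, e, comp_assoc.
Qed.

Definition Span (CC : Category) : Category.
Proof.
  refine {| Ob := SpanOb CC;
            Hom := @SpanHom CC;
            idm := fun S => {| sh_D := id_ (sp_D S);
                               sh_0 := id_ (sp_D0 S);
                               sh_1 := id_ (sp_D1 S);
                               sh_d := square_id (sp_d S);
                               sh_c := square_id (sp_c S) |};
            comp := fun S T U k h =>
              {| sh_D := sh_D k ∘ sh_D h;
                 sh_0 := sh_0 k ∘ sh_0 h;
                 sh_1 := sh_1 k ∘ sh_1 h;
                 sh_d := square_comp (sh_d k) (sh_d h);
                 sh_c := square_comp (sh_c k) (sh_c h) |} |}.
  - intros S T h; apply SpanHom_eq; apply comp_idl.
  - intros S T h; apply SpanHom_eq; apply comp_idr.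
  - intros S T U V l k h; apply SpanHom_eq; apply comp_assoc.
Defined.

Definition SpanClass (CC : Category) : Type := Span CC -> Prop.

Definition mkSpan {CC : Category} {D D0 D1 : CC} (d : D ~> D0) (c : D ~> D1) :
  Span CC :=
  {| sp_D := D; sp_D0 := D0; sp_D1 := D1; sp_d := d; sp_c := c |}.

Definition M0 {CC : Category} : SpanClass CC := fun S : SpanOb CC =>
  HasKernelPair (sp_d S) /\ HasKernelPair (sp_c S).

Definition M1 {CC : Category} : SpanClass CC := fun S : SpanOb CC =>
  M0 S /\ JointlyMonic (sp_d S) (sp_c S).

Definition M2 {CC : Category} : SpanClass CC := fun S : SpanOb CC =>
  M0 S /\ JointlyStronglyMonic (sp_d S) (sp_c S).

Definition SpanM {CC : Category} (M : SpanClass CC) : Category := FullSub M.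

Record RGOb (CC : Category) : Type := {
  rg_C1 : CC;
  rg_C0 : CC;
  rg_d : rg_C1 ~> rg_C0;
  rg_e : rg_C0 ~> rg_C1;
  rg_c : rg_C1 ~> rg_C0;
  rg_de : rg_d ∘ rg_e = id_ rg_C0;
  rg_ce : rg_c ∘ rg_e = id_ rg_C0
}.

Record RGHom (CC : Category) (G H : RGOb CC) : Type := {
  rh_1 : rg_C1 G ~> rg_C1 H;
  rh_0 : rg_C0 G ~> rg_C0 H;
  rh_d : rg_d H ∘ rh_1 = rh_0 ∘ rg_d G;
  rh_c : rg_c H ∘ rh_1 = rh_0 ∘ rg_c G;
  rh_e : rg_e H ∘ rh_0 = rh_1 ∘ rg_e G
}.

Lemma RGHom_eq (CC : Category) (G H : RGOb CC) (h k : RGHom G H) :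
  rh_1 h = rh_1 k -> rh_0 h = rh_0 k -> h = k.
Proof.
  destruct h as [a b p q r], k as [a' b' p' q' r']; simpl.
  intros; subst a' b'.
  now rewrite (proof_irrelevance _ p p'), (proof_irrelevance _ q q'),
    (proof_irrelevance _ r r').
Qed.

Definition RG (CC : Category) : Category.
Proof.
  refine {| Ob := RGOb CC;
            Hom := @RGHom CC;
            idm := fun G => {| rh_1 := id_ (rg_C1 G);
                               rh_0 := id_ (rg_C0 G);
                               rh_d := square_id (rg_d G);
                               rh_c := square_id (rg_c G);
                               rh_e := square_id (rg_e G) |};
            comp := fun G H K k h =>
              {| rh_1 := rh_1 k ∘ rh_1 h;
                 rh_0 := rh_0 k ∘ rh_0 h;
                 rh_d := square_comp (rh_d k) (rh_d h);
                 rh_c := square_comp (rh_c k) (rh_c h);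
                 rh_e := square_comp (rh_e k) (rh_e h) |} |}.
  - intros G H h; apply RGHom_eq; apply comp_idl.
  - intros G H h; apply RGHom_eq; apply comp_idr.
  - intros G H K L l k h; apply RGHom_eq; apply comp_assoc.
Defined.

Definition rg_span {CC : Category} (G : RG CC) : Span CC :=
  mkSpan (rg_d G) (rg_c G).

Definition rg_cospan {CC : Category} (G : RG CC) :
  SplitCospan (rg_C1 G) (rg_C0 G) (rg_C1 G) :=
  {| sc_f := rg_d G; sc_r := rg_e G; sc_g := rg_c G; sc_s := rg_e G;
     sc_fr := rg_de G; sc_gs := rg_ce G |}.

Section InternalStructures.
Context {CC : Category} (LP : LocalProducts CC).

Record UMGStr (G : RG CC) : Type := {
  um_m : lp LP (rg_cospan G) ~> rg_C1 G;
  um_dm : rg_d G ∘ um_m = rg_d G ∘ lp_2 LP (rg_cospan G);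
  um_cm : rg_c G ∘ um_m = rg_c G ∘ lp_1 LP (rg_cospan G);
  um_e1 : um_m ∘ lp_e1 LP (rg_cospan G) = id_ (rg_C1 G);
  um_e2 : um_m ∘ lp_e2 LP (rg_cospan G) = id_ (rg_C1 G)
}.

Definition rg_lp_map {G H : RG CC} (h : G ~> H) :
    lp LP (rg_cospan G) ~> lp LP (rg_cospan H) :=
  lp_map LP (S := rg_cospan G) (S' := rg_cospan H) (rh_d h) (rh_c h).

Definition umg_pres (G H : RG CC) (s : UMGStr G) (t : UMGStr H) (h : G ~> H) : Prop :=
  rh_1 h ∘ um_m s = um_m t ∘ rg_lp_map h.

Lemma umg_pres_id (G : RG CC) (s : UMGStr G) : umg_pres s s (id_ G).
Proof.
  unfold umg_pres; simpl; rewrite comp_idl.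
  rewrite <- (comp_idr (um_m s)) at 1; f_equal.
  apply (pb_joint (lp_is LP (rg_cospan G))).
  - unfold rg_lp_map; rewrite lp_map_1; simpl; apply square_id.
  - unfold rg_lp_map; rewrite lp_map_2; simpl; apply square_id.
Qed.

Lemma umg_pres_comp (G H K : RG CC) (s : UMGStr G) (t : UMGStr H) (u : UMGStr K)
  (k : H ~> K) (h : G ~> H) :
  umg_pres t u k -> umg_pres s t h -> umg_pres s u (k ∘ h).
Proof.
  unfold umg_pres; intros ek eh; simpl.
  rewrite <- comp_assoc, eh, comp_assoc, ek, <- comp_assoc; f_equal.
  apply (pb_joint (lp_is LP (rg_cospan K))); unfold rg_lp_map.
  - rewrite lp_map_1, comp_assoc, lp_map_1, <- comp_assoc, lp_map_1.
    apply comp_assoc.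
  - rewrite lp_map_2, comp_assoc, lp_map_2, <- comp_assoc, lp_map_2.
    apply comp_assoc.
Qed.

Definition umgStructure : Structure (RG CC) :=
  {| str := UMGStr; pres := umg_pres;
     pres_id := umg_pres_id; pres_comp := umg_pres_comp |}.

Definition UMG : Category := Structured umgStructure.
Definition UMG_RG : Functor UMG (RG CC) := forgetF umgStructure.

Section Multiplication.
Context {G : RG CC} (s : UMGStr G).

(** [m<x, y>] for generalized elements [x], [y]. *)
Definition mul {Z : CC} (x y : Z ~> rg_C1 G) (e : rg_d G ∘ x = rg_c G ∘ y) :
    Z ~> rg_C1 G :=
  um_m s ∘ lp_pair LP (S := rg_cospan G) e.

Lemma mul_d {Z : CC} (x y : Z ~> rg_C1 G) (e : rg_d G ∘ x = rg_c G ∘ y) :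
  rg_d G ∘ mul e = rg_d G ∘ y.
Proof.
  unfold mul; rewrite comp_assoc, um_dm, <- comp_assoc; f_equal; apply pair_2.
Qed.

Lemma mul_c {Z : CC} (x y : Z ~> rg_C1 G) (e : rg_d G ∘ x = rg_c G ∘ y) :
  rg_c G ∘ mul e = rg_c G ∘ x.
Proof.
  unfold mul; rewrite comp_assoc, um_cm, <- comp_assoc; f_equal; apply pair_1.
Qed.

Definition IsAssociative : Prop :=
  forall (Z : CC) (x y z : Z ~> rg_C1 G)
    (exy : rg_d G ∘ x = rg_c G ∘ y) (eyz : rg_d G ∘ y = rg_c G ∘ z),
    mul (x := mul exy) (y := z) (eq_trans (mul_d exy) eyz) =
    mul (x := x) (y := mul eyz) (eq_trans exy (eq_sym (mul_c eyz))).

Definition HasInverses : Prop :=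
  exists (i : rg_C1 G ~> rg_C1 G)
    (di : rg_d G ∘ i = rg_c G) (ci : rg_c G ∘ i = rg_d G),
    mul (x := id_ (rg_C1 G)) (y := i)
        (eq_trans (comp_idr (rg_d G)) (eq_sym ci)) = rg_e G ∘ rg_c G /\
    mul (x := i) (y := id_ (rg_C1 G))
        (eq_trans di (eq_sym (comp_idr (rg_c G)))) = rg_e G ∘ rg_d G.
End Multiplication.

Definition Cat : Category := FullSub (fun G : UMG => IsAssociative (the_str G)).
Definition Cat_UMG : Functor Cat UMG := inclF _.
Definition Cat_RG : Functor Cat (RG CC) := compF UMG_RG Cat_UMG.

Definition Grpd : Category :=
  FullSub (fun G : Cat => HasInverses (the_str (sub_ob G))).
Definition Grpd_Cat : Functor Grpd Cat := inclF _.
Definition Grpd_RG : Functor Grpd (RG CC) := compF Cat_RG Grpd_Cat.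

(** For [F : X -> RG CC], the restriction of [F] to the full subcategories of
    those objects whose underlying span is in [M]. *)
Definition overM (X : Category) (F : Functor X (RG CC)) (M : SpanClass CC) :
  Functor (FullSub (fun G : X => M (rg_span (F G))))
          (FullSub (fun G : RG CC => M (rg_span G))) :=
  restrictF F (fun G : RG CC => M (rg_span G)).

Definition chosen_kernel_pair {A B : CC} (f : A ~> B) (H : HasKernelPair f) :
    Pullback f f :=
  proj1_sig (constructive_indefinite_description (fun _ : Pullback f f => True)
    (match H with inhabits P => ex_intro _ P I end)).

Definition kp_diag {A B : CC} (f : A ~> B) (P : Pullback f f) : A ~> pb_ob P :=
  pair (pb_is P) (eq_refl (f ∘ id_ A)).

Section Triples.
Variable S : SpanM (@M0 CC).
Let D := sp_D (sub_ob S).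
Let d : D ~> sp_D0 (sub_ob S) := sp_d (sub_ob S).
Let c : D ~> sp_D1 (sub_ob S) := sp_c (sub_ob S).
Let Kd : Pullback d d := chosen_kernel_pair (proj1 (sub_in S)).
Let Kc : Pullback c c := chosen_kernel_pair (proj2 (sub_in S)).

Definition tr_cospan : SplitCospan (pb_ob Kd) D (pb_ob Kc) :=
  {| sc_f := pb_2 Kd; sc_r := kp_diag Kd; sc_g := pb_1 Kc; sc_s := kp_diag Kc;
     sc_fr := pair_2 (pb_is Kd) (eq_refl (d ∘ id_ D));
     sc_gs := pair_1 (pb_is Kc) (eq_refl (c ∘ id_ D)) |}.

(** The object [D(d,c)] of triples [<x, y, z>] with [dx = dy] and [cy = cz],
    built as the local product over [D] of the kernel pairs of [d] and [c]. *)
Definition tr_ob : CC := lp LP tr_cospan.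
Definition tr_1 : tr_ob ~> D := pb_1 Kd ∘ lp_1 LP tr_cospan.
Definition tr_2 : tr_ob ~> D := pb_2 Kd ∘ lp_1 LP tr_cospan.
Definition tr_3 : tr_ob ~> D := pb_2 Kc ∘ lp_2 LP tr_cospan.

Lemma tr_2_alt : tr_2 = pb_1 Kc ∘ lp_2 LP tr_cospan.
Proof. exact (pb_comm (lp_is LP tr_cospan)). Qed.

Lemma tr_d : d ∘ tr_1 = d ∘ tr_2.
Proof. unfold tr_1, tr_2; now rewrite !comp_assoc, (pb_comm (pb_is Kd)). Qed.

Lemma tr_c : c ∘ tr_2 = c ∘ tr_3.
Proof.
  rewrite tr_2_alt; unfold tr_3; now rewrite !comp_assoc, (pb_comm (pb_is Kc)).
Qed.

Section Triple.
Context {Z : CC} {x y z : Z ~> D} (ed : d ∘ x = d ∘ y) (ec : c ∘ y = c ∘ z).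

Lemma triple_eq :
  sc_f tr_cospan ∘ pair (pb_is Kd) ed = sc_g tr_cospan ∘ pair (pb_is Kc) ec.
Proof. simpl; now rewrite pair_1, pair_2. Qed.

Definition triple : Z ~> tr_ob := lp_pair LP triple_eq.

Lemma triple_1 : tr_1 ∘ triple = x.
Proof.
  unfold tr_1, triple, lp_1, lp_pair; rewrite <- comp_assoc.
  rewrite (pair_1 (lp_is LP tr_cospan)); apply pair_1.
Qed.

Lemma triple_2 : tr_2 ∘ triple = y.
Proof.
  unfold tr_2, triple, lp_1, lp_pair; rewrite <- comp_assoc.
  rewrite (pair_1 (lp_is LP tr_cospan)); apply pair_2.
Qed.

Lemma triple_3 : tr_3 ∘ triple = z.
Proof.
  unfold tr_3, triple, lp_2, lp_pair; rewrite <- comp_assoc.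
  rewrite (pair_2 (lp_is LP tr_cospan)); apply pair_2.
Qed.
End Triple.

Lemma tr_joint (Z : CC) (u v : Z ~> tr_ob) :
  tr_1 ∘ u = tr_1 ∘ v -> tr_2 ∘ u = tr_2 ∘ v -> tr_3 ∘ u = tr_3 ∘ v -> u = v.
Proof.
  intros e1 e2 e3.
  assert (e2' := e2); rewrite tr_2_alt in e2'.
  unfold tr_1, tr_2, tr_3 in *; rewrite <- !comp_assoc in *.
  apply (pb_joint (lp_is LP tr_cospan)).
  - now apply (pb_joint (pb_is Kd)).
  - now apply (pb_joint (pb_is Kc)).
Qed.

Definition dom : tr_ob ~> D := tr_1.
Definition cod : tr_ob ~> D := tr_3.

Record PreGrpdStr : Type := {
  pg_p : tr_ob ~> D;
  pg_xyy : forall (Z : CC) (x y : Z ~> D) (e : d ∘ x = d ∘ y),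
    pg_p ∘ triple (x := x) (y := y) (z := y) e eq_refl = x;
  pg_yyz : forall (Z : CC) (y z : Z ~> D) (e : c ∘ y = c ∘ z),
    pg_p ∘ triple (x := y) (y := y) (z := z) eq_refl e = z;
  pg_d : d ∘ pg_p = d ∘ cod;
  pg_c : c ∘ pg_p = c ∘ dom
}.
End Triples.

Section TripleMap.
Context {S T : SpanM (@M0 CC)} (h : S ~> T).

Lemma tr_map_d :
  sp_d (sub_ob T) ∘ (sh_D h ∘ tr_1 S) = sp_d (sub_ob T) ∘ (sh_D h ∘ tr_2 S).
Proof. rewrite !comp_assoc, sh_d, <- !comp_assoc; f_equal; apply tr_d. Qed.

Lemma tr_map_c :
  sp_c (sub_ob T) ∘ (sh_D h ∘ tr_2 S) = sp_c (sub_ob T) ∘ (sh_D h ∘ tr_3 S).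
Proof. rewrite !comp_assoc, sh_c, <- !comp_assoc; f_equal; apply tr_c. Qed.

Definition tr_map : tr_ob S ~> tr_ob T := triple tr_map_d tr_map_c.
End TripleMap.

Definition pregrpd_pres (S T : SpanM (@M0 CC)) (p : PreGrpdStr S) (q : PreGrpdStr T)
    (h : S ~> T) : Prop :=
  sh_D h ∘ pg_p p = pg_p q ∘ tr_map h.

Lemma pregrpd_pres_id (S : SpanM (@M0 CC)) (p : PreGrpdStr S) :
  pregrpd_pres p p (id_ S).
Proof.
  unfold pregrpd_pres; simpl; rewrite comp_idl.
  rewrite <- (comp_idr (pg_p p)) at 1; f_equal.
  apply tr_joint; unfold tr_map;
    rewrite ?triple_1, ?triple_2, ?triple_3; simpl; apply square_id.
Qed.

Lemma pregrpd_pres_comp (S T U : SpanM (@M0 CC))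
  (p : PreGrpdStr S) (q : PreGrpdStr T) (r : PreGrpdStr U)
  (k : T ~> U) (h : S ~> T) :
  pregrpd_pres q r k -> pregrpd_pres p q h -> pregrpd_pres p r (k ∘ h).
Proof.
  unfold pregrpd_pres; intros ek eh; simpl.
  rewrite <- comp_assoc, eh, comp_assoc, ek, <- comp_assoc; f_equal.
  apply tr_joint; unfold tr_map.
  - rewrite triple_1, comp_assoc, triple_1, <- comp_assoc, triple_1.
    apply comp_assoc.
  - rewrite triple_2, comp_assoc, triple_2, <- comp_assoc, triple_2.
    apply comp_assoc.
  - rewrite triple_3, comp_assoc, triple_3, <- comp_assoc, triple_3.
    apply comp_assoc.
Qed.

Definition pregrpdStructure : Structure (SpanM (@M0 CC)) :=
  {| str := PreGrpdStr; pres := pregrpd_pres;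
     pres_id := pregrpd_pres_id; pres_comp := pregrpd_pres_comp |}.

(** All pregroupoids; those with span in [M] form the domain of
    [PreGrpdM_SpanM M], for [M] contained in [M0]. *)
Definition PreGrpd : Category := Structured pregrpdStructure.
Definition PreGrpd_Span : Functor PreGrpd (Span CC) :=
  compF (inclF (@M0 CC)) (forgetF pregrpdStructure).

Definition PreGrpdM_SpanM (M : SpanClass CC) :
  Functor (FullSub (fun S : PreGrpd => M (PreGrpd_Span S))) (SpanM M) :=
  restrictF PreGrpd_Span M.

Record DiKiteOb : Type := {
  dk_A : CC;
  dk_B : CC;
  dk_C : CC;
  dk_cospan : SplitCospan dk_A dk_B dk_C;
  dk_span : Span CC;
  dk_alpha : dk_A ~> sp_D dk_span;
  dk_beta : dk_B ~> sp_D dk_span;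
  dk_gamma : dk_C ~> sp_D dk_span;
  dk_alpha_r : dk_alpha ∘ sc_r dk_cospan = dk_beta;
  dk_gamma_s : dk_gamma ∘ sc_s dk_cospan = dk_beta;
  dk_d : sp_d dk_span ∘ dk_alpha = sp_d dk_span ∘ dk_beta ∘ sc_f dk_cospan;
  dk_c : sp_c dk_span ∘ dk_beta ∘ sc_g dk_cospan = sp_c dk_span ∘ dk_gamma
}.

Record DiKiteHom (K L : DiKiteOb) : Type := {
  kh_A : dk_A K ~> dk_A L;
  kh_B : dk_B K ~> dk_B L;
  kh_C : dk_C K ~> dk_C L;
  kh_span : dk_span K ~> dk_span L;
  kh_f : sc_f (dk_cospan L) ∘ kh_A = kh_B ∘ sc_f (dk_cospan K);
  kh_r : sc_r (dk_cospan L) ∘ kh_B = kh_A ∘ sc_r (dk_cospan K);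
  kh_g : sc_g (dk_cospan L) ∘ kh_C = kh_B ∘ sc_g (dk_cospan K);
  kh_s : sc_s (dk_cospan L) ∘ kh_B = kh_C ∘ sc_s (dk_cospan K);
  kh_alpha : dk_alpha L ∘ kh_A = sh_D kh_span ∘ dk_alpha K;
  kh_beta : dk_beta L ∘ kh_B = sh_D kh_span ∘ dk_beta K;
  kh_gamma : dk_gamma L ∘ kh_C = sh_D kh_span ∘ dk_gamma K
}.

Lemma DiKiteHom_eq (K L : DiKiteOb) (h k : DiKiteHom K L) :
  kh_A h = kh_A k -> kh_B h = kh_B k -> kh_C h = kh_C k ->
  kh_span h = kh_span k -> h = k.
Proof.
  destruct h as [a b c s h1 h2 h3 h4 h5 h6 h7],
    k as [a' b' c' s' k1 k2 k3 k4 k5 k6 k7]; simpl.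
  intros; subst a' b' c' s'.
  f_equal; apply proof_irrelevance.
Qed.

Definition DiKite : Category.
Proof.
  refine {| Ob := DiKiteOb;
            Hom := DiKiteHom;
            idm := fun K =>
              {| kh_A := id_ (dk_A K);
                 kh_B := id_ (dk_B K);
                 kh_C := id_ (dk_C K);
                 kh_span := id_ (dk_span K);
                 kh_f := square_id _; kh_r := square_id _;
                 kh_g := square_id _; kh_s := square_id _;
                 kh_alpha := square_id _; kh_beta := square_id _;
                 kh_gamma := square_id _ |};
            comp := fun K L N k h =>
              {| kh_A := kh_A k ∘ kh_A h;
                 kh_B := kh_B k ∘ kh_B h;
                 kh_C := kh_C k ∘ kh_C h;
                 kh_span := kh_span k ∘ kh_span h;
                 kh_f := square_comp (kh_f k) (kh_f h);
                 kh_r := square_comp (kh_r k) (kh_r h);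
                 kh_g := square_comp (kh_g k) (kh_g h);
                 kh_s := square_comp (kh_s k) (kh_s h);
                 kh_alpha := square_comp (kh_alpha k) (kh_alpha h);
                 kh_beta := square_comp (kh_beta k) (kh_beta h);
                 kh_gamma := square_comp (kh_gamma k) (kh_gamma h) |} |}.
  - intros K L h; apply DiKiteHom_eq; apply comp_idl.
  - intros K L h; apply DiKiteHom_eq; apply comp_idr.
  - intros K L N P l k h; apply DiKiteHom_eq; apply comp_assoc.
Defined.

Record MKiteStr (K : DiKite) : Type := {
  mk_m : lp LP (dk_cospan K) ~> sp_D (dk_span K);
  mk_dm : sp_d (dk_span K) ∘ mk_m =
    sp_d (dk_span K) ∘ dk_gamma K ∘ lp_2 LP (dk_cospan K);
  mk_cm : sp_c (dk_span K) ∘ mk_m =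
    sp_c (dk_span K) ∘ dk_alpha K ∘ lp_1 LP (dk_cospan K);
  mk_e1 : mk_m ∘ lp_e1 LP (dk_cospan K) = dk_alpha K;
  mk_e2 : mk_m ∘ lp_e2 LP (dk_cospan K) = dk_gamma K
}.

Definition dk_lp_map {K L : DiKite} (h : K ~> L) :
    lp LP (dk_cospan K) ~> lp LP (dk_cospan L) :=
  lp_map LP (kh_f h) (kh_g h).

Definition mkite_pres (K L : DiKite) (s : MKiteStr K) (t : MKiteStr L) (h : K ~> L) :
    Prop :=
  sh_D (kh_span h) ∘ mk_m s = mk_m t ∘ dk_lp_map h.

Lemma mkite_pres_id (K : DiKite) (s : MKiteStr K) : mkite_pres s s (id_ K).
Proof.
  unfold mkite_pres; simpl; rewrite comp_idl.
  rewrite <- (comp_idr (mk_m s)) at 1; f_equal.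
  apply (pb_joint (lp_is LP (dk_cospan K))); unfold dk_lp_map.
  - rewrite lp_map_1; simpl; apply square_id.
  - rewrite lp_map_2; simpl; apply square_id.
Qed.

Lemma mkite_pres_comp (K L N : DiKite)
  (s : MKiteStr K) (t : MKiteStr L) (u : MKiteStr N) (k : L ~> N) (h : K ~> L) :
  mkite_pres t u k -> mkite_pres s t h -> mkite_pres s u (k ∘ h).
Proof.
  unfold mkite_pres; intros ek eh; simpl.
  rewrite <- comp_assoc, eh, comp_assoc, ek, <- comp_assoc; f_equal.
  apply (pb_joint (lp_is LP (dk_cospan N))); unfold dk_lp_map.
  - rewrite lp_map_1, comp_assoc, lp_map_1, <- comp_assoc, lp_map_1.
    apply comp_assoc.
  - rewrite lp_map_2, comp_assoc, lp_map_2, <- comp_assoc, lp_map_2.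
    apply comp_assoc.
Qed.

Definition mkiteStructure : Structure DiKite :=
  {| str := MKiteStr; pres := mkite_pres;
     pres_id := mkite_pres_id; pres_comp := mkite_pres_comp |}.

Definition MKite : Category := Structured mkiteStructure.
Definition MKite_DiKite : Functor MKite DiKite := forgetF mkiteStructure.

Definition MKiteM_DiKiteM (M : SpanClass CC) :
  Functor (FullSub (fun K : MKite => M (dk_span (MKite_DiKite K))))
          (FullSub (fun K : DiKite => M (dk_span K))) :=
  restrictF MKite_DiKite (fun K : DiKite => M (dk_span K)).

End InternalStructures.

Definition CondC11 {CC : Category} (M : SpanClass CC) : Prop :=
  forall (A C E D D0 D1 : CC)
    (p1 : E ~> A) (e1 : A ~> E) (p2 : E ~> C) (e2 : C ~> E)
    (alpha : A ~> D) (beta : E ~> D) (gamma : C ~> D)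
    (d : D ~> D0) (c : D ~> D1),
    JointlyMonic p1 p2 -> M (mkSpan d c) -> M (mkSpan p1 p2) ->
    p1 ∘ e1 = id_ A -> p2 ∘ e2 = id_ C ->
    e1 ∘ p1 ∘ e2 ∘ p2 = e2 ∘ p2 ∘ e1 ∘ p1 ->
    alpha ∘ p1 ∘ e2 ∘ p2 = beta -> beta = gamma ∘ p2 ∘ e1 ∘ p1 ->
    d ∘ alpha ∘ p1 = d ∘ alpha ∘ p1 ∘ e2 ∘ p2 ->
    c ∘ gamma ∘ p2 = c ∘ gamma ∘ p2 ∘ e1 ∘ p1 ->
    exists! m : E ~> D,
      m ∘ e1 = alpha /\ m ∘ e2 = gamma /\
      d ∘ m = d ∘ gamma ∘ p2 /\ c ∘ m = c ∘ alpha ∘ p1.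

Inductive CondIndex : Type := c1 | c2 | c3 | c4 | c5 | c6 | c7 | c8 | c9 | c10 | c11.

Definition Condition {CC : Category} (LP : LocalProducts CC) (M : SpanClass CC)
    (k : CondIndex) : Prop :=
  match k with
  | c1 => IsIsomorphism (overM (Grpd_RG LP) M)
  | c2 => HasSection (overM (Grpd_RG LP) M)
  | c3 => IsIsomorphism (overM (Cat_RG LP) M)
  | c4 => HasSection (overM (Cat_RG LP) M)
  | c5 => IsIsomorphism (overM (UMG_RG LP) M)
  | c6 => HasSection (overM (UMG_RG LP) M)
  | c7 => IsIsomorphism (PreGrpdM_SpanM LP M)
  | c8 => HasSection (PreGrpdM_SpanM LP M)
  | c9 => IsIsomorphism (MKiteM_DiKiteM LP M)
  | c10 => HasSection (MKiteM_DiKiteM LP M)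
  | c11 => CondC11 M
  end.

Definition NaturallyMaltsevType {CC : Category} (LP : LocalProducts CC) : Prop :=
  IsIsomorphism (Grpd_RG LP).

Definition MaltsevType (CC : Category) : Prop :=
  forall G : RG CC, JointlyMonic (rg_d G) (rg_c G) ->
    exists i : rg_C1 G ~> rg_C1 G, rg_d G ∘ i = rg_c G /\ rg_c G ∘ i = rg_d G.

Definition WeaklyMaltsevType (CC : Category) : Prop :=
  forall (A C E : CC) (p1 : E ~> A) (e1 : A ~> E) (p2 : E ~> C) (e2 : C ~> E),
    IsLocalProduct p1 e1 p2 e2 -> JointlyEpic e1 e2.

Definition IsExtremal {CC : Category} {A C E : CC}
    (p1 : E ~> A) (e1 : A ~> E) (p2 : E ~> C) (e2 : C ~> E) : Prop :=
  forall (D D0 D1 : CC) (d : D ~> D0) (c : D ~> D1), M1 (mkSpan d c) ->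
  forall (alpha : A ~> D) (gamma : C ~> D),
    d ∘ alpha = d ∘ gamma ∘ p2 ∘ e1 -> c ∘ gamma = c ∘ alpha ∘ p1 ∘ e2 ->
    exists! m : E ~> D,
      d ∘ m = d ∘ gamma ∘ p2 /\ c ∘ m = c ∘ alpha ∘ p1 /\
      m ∘ e1 = alpha /\ m ∘ e2 = gamma.

(* Main.v *)
From Stdlib Require Import FunctionalExtensionality IndefiniteDescription ProofIrrelevance.
Require Import Defs.

(** Everything passes through two conditions on a class [M] closed under a few operations:
    every span in [M] carries a pregroupoid operation preserved by all span morphisms, and
    every kite over a span in [M] has a unique multiplication on every local product.

    A section over reflexive graphs, applied to the graph of triples [<x, y, z>] with
    [dx = dy] and [cy = cz], gives the natural operation; naturality along the maps out of
    a local product gives (c11), hence the unique kite multiplications. Conversely, unique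
    multiplications determine compositions and pregroupoid operations; they are preserved
    by all morphisms, are associative and admit inverses, because the two sides of each
    equation multiply the same kite. *)

Set Implicit Arguments.
Unset Strict Implicit.
Unset Printing Implicit Defensive.

(** * Isomorphisms of categories and sections *)

(** A section asserts only existence, while half of the conditions demand uniqueness. Uniqueness is
    extracted from naturality: the projections of a local product form a span in the class, their
    joint monicity forces the value of its operation on the relevant triple, and a kite
    multiplication is itself a morphism out of that span. The passage through triples needs the
    graph of triples to stay in the class. This holds because the legs of the middle term y of
    [<x, y, z>] are prescribed by x and z, so that joint (strong) monicity passes from [(d, c)] to
    the outer projections. Isomorphisms and sections are strict equalities of functors, hence
    involve transport along equalities of objects. Operations and multiplications are therefore
    described by generalized elements and equations, and functors reappear only where a condition is
    entered or left. *)

Definition hom_cast (X : Category) (A A' B B' : X) (p : A = A') (q : B = B') :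
    A ~> B -> A' ~> B' :=
  match p in _ = a, q in _ = b return A ~> B -> a ~> b with
  | eq_refl, eq_refl => fun f => f
  end.

Lemma hom_cast_id (X : Category) (A A' : X) (p q : A = A') :
  hom_cast p q (id_ A) = id_ A'.
Proof. now rewrite (proof_irrelevance _ q p); destruct p. Qed.

Lemma hom_cast_comp (X : Category) (A A' B B' C C' : X)
  (p : A = A') (q : B = B') (r : C = C') (g : B ~> C) (f : A ~> B) :
  hom_cast p r (g ∘ f) = hom_cast q r g ∘ hom_cast p q f.
Proof. now destruct p, q, r. Qed.

Lemma hom_cast_cast (X : Category) (A A' A'' B B' B'' : X)
  (p : A = A') (p' : A' = A'') (q : B = B') (q' : B' = B'') (r : A = A'') (s : B = B'')
  (f : A ~> B) :
  hom_cast p' q' (hom_cast p q f) = hom_cast r s f.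
Proof.
  destruct p, p', q, q'.
  now rewrite (proof_irrelevance _ r eq_refl), (proof_irrelevance _ s eq_refl).
Qed.

Lemma hom_cast_refl (X : Category) (A B : X) (p : A = A) (q : B = B) (f : A ~> B) :
  hom_cast p q f = f.
Proof.
  now rewrite (proof_irrelevance _ p eq_refl), (proof_irrelevance _ q eq_refl).
Qed.

Lemma fmor_cast (X Y : Category) (F : Functor X Y) (A A' B B' : X)
  (p : A = A') (q : B = B') (p' : F A = F A') (q' : F B = F B') (f : A ~> B) :
  fmor F (hom_cast p q f) = hom_cast p' q' (fmor F f).
Proof. destruct p, q; symmetry; apply hom_cast_refl. Qed.

(** Once functional extensionality identifies the object maps, every cast is along an equality of an
    object with itself, which proof irrelevance makes trivial. *)
Lemma functor_eq (X Y : Category) (F G : Functor X Y) (p : forall A, F A = G A) :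
  (forall (A B : X) (f : A ~> B), hom_cast (p A) (p B) (fmor F f) = fmor G f) -> F = G.
Proof.
  destruct F as [fo fm fi fc], G as [go gm gi gc]; simpl in *.
  assert (e : fo = go) by (apply functional_extensionality, p).
  subst go; intros h.
  assert (e : fm = gm).
  { extensionality A; extensionality B; extensionality f.
    rewrite <- h; symmetry; apply hom_cast_refl. }
  subst gm; f_equal; apply proof_irrelevance.
Qed.

(** Bijectivity on objects, up to equality, and on morphisms, over the part of [Y] cut out by [P].
    Being a statement about [F] and not about its restriction, it can be passed along the chain from
    unital multiplicative graphs to categories and groupoids. *)
Record UniquelyLiftsOver (X Y : Category) (F : Functor X Y) (P : Y -> Prop) : Prop := {
  lift_ob : forall y : Y, P y -> exists x : X, F x = y;
  lift_ob_unique : forall x x' : X, P (F x) -> F x = F x' -> x = x';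
  lift_faithful : forall (x x' : X) (f f' : x ~> x'), fmor F f = fmor F f' -> f = f';
  lift_full : forall (x x' : X), P (F x) -> P (F x') ->
    forall h : F x ~> F x', exists f : x ~> x', fmor F f = h
}.

Lemma uniquely_lifts_iso (X Y : Category) (F : Functor X Y) :
  UniquelyLiftsOver F (fun _ => True) -> IsIsomorphism F.
Proof.
  intros H.
  destruct (functional_choice (fun (y : Y) (x : X) => F x = y)
              (fun y => lift_ob H (y := y) I)) as [g Fg].
  assert (gF : forall x, g (F x) = x)
    by (intros x; apply (lift_ob_unique H); trivial).
  pose (lift x x' (h : F x ~> F x') :=
    proj1_sig (constructive_indefinite_description _
      (lift_full H (x := x) (x' := x') I I h))).
  assert (Flift : forall x x' (h : F x ~> F x'), fmor F (lift x x' h) = h)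
    by (intros x x' h; apply proj2_sig).
  (* The inverse lifts [f] after transporting it to a morphism between objects in the image of [F];
     faithfulness then makes it a functor. *)
  pose (gm A B (f : A ~> B) :=
    lift (g A) (g B) (hom_cast (eq_sym (Fg A)) (eq_sym (Fg B)) f)).
  assert (gmE : forall A B (f : A ~> B),
    fmor F (gm A B f) = hom_cast (eq_sym (Fg A)) (eq_sym (Fg B)) f)
    by (intros; apply Flift).
  unshelve epose (G := {| fob := g; fmor := gm |} : Functor Y X).
  - intros A; apply (lift_faithful H); rewrite gmE, fmor_id; apply hom_cast_id.
  - intros A B C k f; apply (lift_faithful H).
    rewrite fmor_comp, !gmE; apply hom_cast_comp.
  - exists G; split.
    + apply (@functor_eq Y Y (compF F G) (idF Y) Fg); simpl.
      intros A B f; rewrite gmE.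
      exact (hom_cast_cast _ _ _ _ eq_refl eq_refl f).
    + apply (@functor_eq X X (compF G F) (idF X) gF); simpl.
      intros A B f; apply (lift_faithful H).
      rewrite (fmor_cast _ _ (f_equal _ (gF A)) (f_equal _ (gF B))), gmE.
      exact (hom_cast_cast _ _ _ _ eq_refl eq_refl _).
Qed.

Lemma sub_ob_inj (X : Category) (P : X -> Prop) (A B : SubOb P) :
  sub_ob A = sub_ob B -> A = B.
Proof.
  destruct A as [a p], B as [b q]; simpl; intros e; subst b.
  now rewrite (proof_irrelevance _ p q).
Qed.

Lemma restrictF_iso (X Y : Category) (F : Functor X Y) (P : Y -> Prop) :
  UniquelyLiftsOver F P -> IsIsomorphism (restrictF F P).
Proof.
  intros H; apply uniquely_lifts_iso; split.
  - intros [y hy] _; destruct (lift_ob H hy) as [x e]; subst y.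
    now exists {| sub_ob := x; sub_in := hy |}.
  - intros [x p] [x' p'] _ e; apply sub_ob_inj, (lift_ob_unique H p).
    exact (f_equal sub_ob e).
  - intros x x' f f'; apply (lift_faithful H).
  - intros x x' _ _ h; exact (lift_full H (sub_in x) (sub_in x') h).
Qed.

(** Uniqueness of structures gives injectivity on objects; automatic preservation gives fullness. *)
Lemma forgetF_lifts (X : Category) (T : Structure X) (P : X -> Prop) :
  (forall A, P A -> exists s : str T A, True) ->
  (forall A, P A -> forall s t : str T A, s = t) ->
  (forall A B, P A -> P B -> forall (s : str T A) (t : str T B) (h : A ~> B), pres s t h) ->
  UniquelyLiftsOver (forgetF T) P.
Proof.
  intros he hu hp; split.
  - intros A hA; destruct (he A hA) as [s _].
    now exists (Build_StrOb s).
  - intros [A s] [A' s'] hA e; simpl in *; subst A'.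
    now rewrite (hu A hA s s').
  - intros A B f f' e; now apply StrHom_eq.
  - intros A B hA hB h.
    now exists (Build_StrHom (hp _ _ hA hB (the_str A) (the_str B) h)).
Qed.

(** Serves to add associativity, then inverses, once these are automatic over [P]. *)
Lemma lifts_full_sub (X Y : Category) (F : Functor X Y) (P : Y -> Prop) (Q : X -> Prop) :
  UniquelyLiftsOver F P -> (forall x, P (F x) -> Q x) ->
  UniquelyLiftsOver (compF F (inclF Q)) P.
Proof.
  intros H hQ; split.
  - intros y hy; destruct (lift_ob H hy) as [x e]; subst y.
    now exists {| sub_ob := x; sub_in := hQ x hy |}.
  - intros x x' hx e; apply sub_ob_inj; exact (lift_ob_unique H hx e).
  - intros x x' f f' e; exact (lift_faithful H e).
  - intros x x' hx hx' h; exact (lift_full H hx hx' h).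
Qed.

(** Pregroupoids are structured over spans in [M0], but a class [M] is a predicate on all spans;
    this bridges the two. *)
Lemma lifts_incl (X Y : Category) (Q : Y -> Prop) (F : Functor X (FullSub Q))
  (P : Y -> Prop) :
  (forall y, P y -> Q y) -> UniquelyLiftsOver F (fun y => P (sub_ob y)) ->
  UniquelyLiftsOver (compF (inclF Q) F) P.
Proof.
  intros hQ H; split.
  - intros y hy.
    destruct (lift_ob H (y := {| sub_ob := y; sub_in := hQ y hy |}) hy) as [x e].
    exists x; simpl; now rewrite e.
  - intros x x' hx e; apply (lift_ob_unique H hx), sub_ob_inj, e.
  - intros x x' f f' e; exact (lift_faithful H e).
  - intros x x' hx hx' h; exact (lift_full H hx hx' h).
Qed.

Lemma iso_section (X Y : Category) (F : Functor X Y) :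
  IsIsomorphism F -> HasSection F.
Proof. intros [G [e _]]; now exists G. Qed.

(** * Equational reasoning in a category *)

Section Composites.
Context {CC : Category}.

(** Composites are kept right-nested, where the left-hand side of an equation need not be a subterm;
    with a common tail [x] attached, [rw] can use the equation in the middle of a composite. *)
Lemma pre1 {A B C Z : CC} {g : B ~> C} {f : A ~> B} {h : A ~> C} (e : g ∘ f = h)
  (x : Z ~> A) : g ∘ (f ∘ x) = h ∘ x.
Proof. now rewrite <- e, comp_assoc. Qed.

Lemma pre2 {A B C D Z : CC} {k : C ~> D} {g : B ~> C} {f : A ~> B} {h : A ~> D}
  (e : k ∘ (g ∘ f) = h) (x : Z ~> A) : k ∘ (g ∘ (f ∘ x)) = h ∘ x.
Proof. now rewrite <- e, !comp_assoc. Qed.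

Lemma pre3 {A B C D E Z : CC} {l : D ~> E} {k : C ~> D} {g : B ~> C} {f : A ~> B}
  {h : A ~> E} (e : l ∘ (k ∘ (g ∘ f)) = h) (x : Z ~> A) :
  l ∘ (k ∘ (g ∘ (f ∘ x))) = h ∘ x.
Proof. now rewrite <- e, !comp_assoc. Qed.
End Composites.

Ltac nrm := rewrite <- ?comp_assoc, ?comp_idl, ?comp_idr.
Ltac nrmin H := rewrite <- ?comp_assoc, ?comp_idl, ?comp_idr in H.
Ltac rw1 e :=
  let H := fresh in
  pose proof e as H; nrmin H;
  first [ rewrite (pre3 H) | rewrite (pre2 H) | rewrite (pre1 H) | rewrite H ];
  clear H; nrm.
Tactic Notation "rw" uconstr(a) := nrm; rw1 a.

Section Kites.
Context {CC : Category} (LP : LocalProducts CC).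

(** * Local products and kernel pairs *)

Lemma lp_local {A B C : CC} (S : SplitCospan A B C) :
  IsLocalProductOf S (lp_1 LP S) (lp_e1 LP S) (lp_2 LP S) (lp_e2 LP S).
Proof.
  split; [apply lp_is|]; repeat split;
    [apply pair_1 | apply pair_2 | apply pair_1 | apply pair_2].
Qed.

(** The kernel pair of a split epimorphism is a local product of two copies of one splitting. *)
Lemma split_epi_kernel_pair {A B : CC} (f : A ~> B) (r : B ~> A) :
  f ∘ r = id_ B -> HasKernelPair f.
Proof.
  intros e; constructor.
  exact (LP {| sc_f := f; sc_r := r; sc_g := f; sc_s := r; sc_fr := e; sc_gs := e |}).
Qed.

Lemma rg_span_M0 (G : RG CC) : M0 (rg_span G).
Proof.
  split; simpl; eapply split_epi_kernel_pair; [apply rg_de | apply rg_ce].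
Qed.

Lemma pair_pre {A B C E : CC} {f : A ~> B} {g : C ~> B} {p1 : E ~> A} {p2 : E ~> C}
  (H : IsPullback f g p1 p2) (Z W : CC) (x : Z ~> A) (y : Z ~> C) (w : W ~> Z)
  (e : f ∘ x = g ∘ y) (e' : f ∘ (x ∘ w) = g ∘ (y ∘ w)) :
  pair H e ∘ w = pair H e'.
Proof.
  apply (pb_joint H); rewrite comp_assoc, ?pair_1, ?pair_2; reflexivity.
Qed.

Lemma pair_ext {A B C E : CC} {f : A ~> B} {g : C ~> B} {p1 : E ~> A} {p2 : E ~> C}
  (H : IsPullback f g p1 p2) (Z : CC) (x x' : Z ~> A) (y y' : Z ~> C)
  (e : f ∘ x = g ∘ y) (e' : f ∘ x' = g ∘ y') :
  x = x' -> y = y' -> pair H e = pair H e'.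
Proof. intros; subst; f_equal; apply proof_irrelevance. Qed.

(** * Composition in a unital multiplicative graph *)

Section Mul.
Context {G : RG CC} (s : UMGStr LP G).

Lemma mul_ext {Z : CC} (x x' y y' : Z ~> rg_C1 G)
  (e : rg_d G ∘ x = rg_c G ∘ y) (e' : rg_d G ∘ x' = rg_c G ∘ y') :
  x = x' -> y = y' -> mul s e = mul s e'.
Proof. intros; unfold mul; f_equal; now apply pair_ext. Qed.

Lemma mul_pre {Z W : CC} (x y : Z ~> rg_C1 G) (w : W ~> Z)
  (e : rg_d G ∘ x = rg_c G ∘ y) (e' : rg_d G ∘ (x ∘ w) = rg_c G ∘ (y ∘ w)) :
  mul s e ∘ w = mul s e'.
Proof. unfold mul; rewrite <- comp_assoc; f_equal; apply pair_pre. Qed.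

Lemma mul_unit_r {Z : CC} (x y : Z ~> rg_C1 G) (e : rg_d G ∘ x = rg_c G ∘ y) :
  y = rg_e G ∘ (rg_d G ∘ x) -> mul s e = x.
Proof.
  intros ey; transitivity (um_m s ∘ lp_e1 LP (rg_cospan G) ∘ x).
  - unfold mul; rewrite <- comp_assoc; f_equal.
    apply (pb_joint (lp_is LP (rg_cospan G))); unfold lp_e1, lp_pair.
    + rewrite comp_assoc, !pair_1; symmetry; apply comp_idl.
    + rewrite comp_assoc, !pair_2; simpl; now rewrite <- comp_assoc.
  - rewrite um_e1; apply comp_idl.
Qed.

Lemma mul_unit_l {Z : CC} (x y : Z ~> rg_C1 G) (e : rg_d G ∘ x = rg_c G ∘ y) :
  x = rg_e G ∘ (rg_c G ∘ y) -> mul s e = y.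
Proof.
  intros ey; transitivity (um_m s ∘ lp_e2 LP (rg_cospan G) ∘ y).
  - unfold mul; rewrite <- comp_assoc; f_equal.
    apply (pb_joint (lp_is LP (rg_cospan G))); unfold lp_e2, lp_pair.
    + rewrite comp_assoc, !pair_1; simpl; now rewrite <- comp_assoc.
    + rewrite comp_assoc, !pair_2; symmetry; apply comp_idl.
  - rewrite um_e2; apply comp_idl.
Qed.

Lemma mul_pre_unit_r {Z W : CC} (x y : Z ~> rg_C1 G) (w : W ~> Z)
  (e : rg_d G ∘ x = rg_c G ∘ y) :
  y ∘ w = rg_e G ∘ (rg_d G ∘ (x ∘ w)) -> mul s e ∘ w = x ∘ w.
Proof.
  intros ey; unshelve erewrite mul_pre.
  - now rewrite !comp_assoc, e.
  - now apply mul_unit_r.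
Qed.

Lemma mul_pre_unit_l {Z W : CC} (x y : Z ~> rg_C1 G) (w : W ~> Z)
  (e : rg_d G ∘ x = rg_c G ∘ y) :
  x ∘ w = rg_e G ∘ (rg_c G ∘ (y ∘ w)) -> mul s e ∘ w = y ∘ w.
Proof.
  intros ex; unshelve erewrite mul_pre.
  - now rewrite !comp_assoc, e.
  - now apply mul_unit_l.
Qed.

Lemma mul_pre_proj {Z : CC} (x y : Z ~> rg_C1 G) (w : lp LP (rg_cospan G) ~> Z)
  (e : rg_d G ∘ x = rg_c G ∘ y) :
  x ∘ w = lp_1 LP (rg_cospan G) -> y ∘ w = lp_2 LP (rg_cospan G) -> mul s e ∘ w = um_m s.
Proof.
  intros ex ey; unfold mul; rewrite <- (comp_idr (um_m s)) at 2.
  rewrite <- comp_assoc; f_equal; unfold lp_pair.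
  apply (pb_joint (lp_is LP (rg_cospan G)));
    rewrite comp_assoc, ?pair_1, ?pair_2; now rewrite comp_idr.
Qed.
End Mul.

Lemma mul_hom {G H : RG CC} (s : UMGStr LP G) (t : UMGStr LP H) (h : G ~> H)
  {Z : CC} (x y : Z ~> rg_C1 G)
  (e : rg_d G ∘ x = rg_c G ∘ y) (e' : rg_d H ∘ (rh_1 h ∘ x) = rg_c H ∘ (rh_1 h ∘ y)) :
  umg_pres s t h -> rh_1 h ∘ mul s e = mul t e'.
Proof.
  intros hp; unfold mul; rewrite comp_assoc, hp, <- comp_assoc; f_equal.
  apply (pb_joint (lp_is LP (rg_cospan H))); unfold rg_lp_map.
  - rewrite comp_assoc, (lp_map_1 LP (S := rg_cospan G) (S' := rg_cospan H)).
    unfold lp_pair; now rewrite <- comp_assoc, !pair_1.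
  - rewrite comp_assoc, (lp_map_2 LP (S := rg_cospan G) (S' := rg_cospan H)).
    unfold lp_pair; now rewrite <- comp_assoc, !pair_2.
Qed.

(** * Natural structures *)

(** A pregroupoid structure on a span, given by its action on generalized elements:
    this does not depend on the choice of an object of triples. *)
Record PreGrpdOp (S : SpanOb CC) : Type := {
  op : forall (Z : CC) (x y z : Z ~> sp_D S),
    sp_d S ∘ x = sp_d S ∘ y -> sp_c S ∘ y = sp_c S ∘ z -> Z ~> sp_D S;
  op_pre : forall (Z W : CC) (w : W ~> Z) (x y z : Z ~> sp_D S) ed ec ed' ec',
    @op Z x y z ed ec ∘ w = @op W (x ∘ w) (y ∘ w) (z ∘ w) ed' ec';
  op_xyy : forall (Z : CC) (x y : Z ~> sp_D S) ed ec, @op Z x y y ed ec = x;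
  op_yyz : forall (Z : CC) (y z : Z ~> sp_D S) ed ec, @op Z y y z ed ec = z;
  op_d : forall (Z : CC) (x y z : Z ~> sp_D S) ed ec,
    sp_d S ∘ @op Z x y z ed ec = sp_d S ∘ z;
  op_c : forall (Z : CC) (x y z : Z ~> sp_D S) ed ec,
    sp_c S ∘ @op Z x y z ed ec = sp_c S ∘ x
}.

Lemma op_ext (S : SpanOb CC) (p : PreGrpdOp S) (Z : CC) (x y z x' y' z' : Z ~> sp_D S)
  ed ec ed' ec' :
  x = x' -> y = y' -> z = z' -> op p (x := x) (y := y) (z := z) ed ec =
    op p (x := x') (y := y') (z := z') ed' ec'.
Proof.
  intros; subst.
  now rewrite (proof_irrelevance _ ed ed'), (proof_irrelevance _ ec ec').
Qed.

Lemma op_pre_xyy (S : SpanOb CC) (p : PreGrpdOp S) (Z W : CC) (w : W ~> Z)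
  (x y z : Z ~> sp_D S) ed ec :
  y ∘ w = z ∘ w -> op p (x := x) (y := y) (z := z) ed ec ∘ w = x ∘ w.
Proof.
  intros e.
  assert (ed' : sp_d S ∘ (x ∘ w) = sp_d S ∘ (y ∘ w)) by now rewrite !comp_assoc, ed.
  rewrite (op_pre p ed ec ed' (f_equal _ e)).
  rewrite <- (op_xyy p ed' eq_refl); now apply op_ext.
Qed.

Lemma op_pre_yyz (S : SpanOb CC) (p : PreGrpdOp S) (Z W : CC) (w : W ~> Z)
  (x y z : Z ~> sp_D S) ed ec :
  x ∘ w = y ∘ w -> op p (x := x) (y := y) (z := z) ed ec ∘ w = z ∘ w.
Proof.
  intros e.
  assert (ec' : sp_c S ∘ (y ∘ w) = sp_c S ∘ (z ∘ w)) by now rewrite !comp_assoc, ec.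
  rewrite (op_pre p ed ec (f_equal _ e) ec').
  rewrite <- (op_yyz p eq_refl ec'); now apply op_ext.
Qed.

(** What a section of the forgetful functor from pregroupoids amounts to, freed from equality of
    functors and from the chosen objects of triples. *)
Definition HasNaturalPreGrpd (M : SpanClass CC) : Prop :=
  exists t : forall S : SpanM M, PreGrpdOp (sub_ob S),
    forall (S T : SpanM M) (h : S ~> T) (Z : CC) (x y z : Z ~> sp_D (sub_ob S))
      ed ec ed' ec',
    sh_D h ∘ op (t S) (x := x) (y := y) (z := z) ed ec =
    op (t T) (x := sh_D h ∘ x) (y := sh_D h ∘ y) (z := sh_D h ∘ z) ed' ec'.

Definition HasNaturalUMG (M : SpanClass CC) : Prop :=
  exists t : forall G : FullSub (fun G : RG CC => M (rg_span G)), UMGStr LP (sub_ob G),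
    forall (G H : FullSub (fun G : RG CC => M (rg_span G))) (h : G ~> H),
      umg_pres (t G) (t H) h.

Definition IsKiteMult {A C E D D0 D1 : CC}
    (p1 : E ~> A) (e1 : A ~> E) (p2 : E ~> C) (e2 : C ~> E)
    (d : D ~> D0) (c : D ~> D1) (alpha : A ~> D) (gamma : C ~> D) (m : E ~> D) : Prop :=
  m ∘ e1 = alpha /\ m ∘ e2 = gamma /\ d ∘ m = d ∘ gamma ∘ p2 /\ c ∘ m = c ∘ alpha ∘ p1.

(** Ranges over all local products, not only the chosen ones, to match extremality and the weak
    Mal'tsev property. The map [beta] of a kite is eliminated as [alpha ∘ sc_r S]. *)
Definition HasUniqueKiteMult (M : SpanClass CC) : Prop :=
  forall (A B C E : CC) (S : SplitCospan A B C)
    (p1 : E ~> A) (e1 : A ~> E) (p2 : E ~> C) (e2 : C ~> E),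
  IsLocalProductOf S p1 e1 p2 e2 ->
  forall (D D0 D1 : CC) (d : D ~> D0) (c : D ~> D1), M (mkSpan d c) ->
  forall (alpha : A ~> D) (gamma : C ~> D),
    alpha ∘ sc_r S = gamma ∘ sc_s S ->
    d ∘ alpha = d ∘ gamma ∘ sc_s S ∘ sc_f S ->
    c ∘ gamma = c ∘ alpha ∘ sc_r S ∘ sc_g S ->
    exists! m : E ~> D, IsKiteMult p1 e1 p2 e2 d c alpha gamma m.

(** The closure properties of a class of spans on which the equivalence of
    (c1)-(c11) relies. *)
Record Admissible (M : SpanClass CC) : Prop := {
  adm_M0 : forall S : SpanOb CC, M S -> M0 S;
  adm_sym : forall (D D0 D1 : CC) (d : D ~> D0) (c : D ~> D1),
    M (mkSpan d c) -> M (mkSpan c d);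
  adm_lp : forall (A B C E : CC) (S : SplitCospan A B C)
    (p1 : E ~> A) (e1 : A ~> E) (p2 : E ~> C) (e2 : C ~> E),
    IsLocalProductOf S p1 e1 p2 e2 -> M (mkSpan p1 p2);
  adm_tr : forall S : SpanM (@M0 CC), M (sub_ob S) -> M (mkSpan (tr_3 LP S) (tr_1 LP S))
}.

Lemma span_eta (S : SpanOb CC) : mkSpan (sp_d S) (sp_c S) = S.
Proof. now destruct S. Qed.

(** * The graph of triples of a span *)

Section Triples.
Variable S : SpanM (@M0 CC).
Notation D := (sp_D (sub_ob S)).

Definition tr_unit : D ~> tr_ob LP S :=
  triple LP (x := id_ D) (y := id_ D) (z := id_ D) eq_refl eq_refl.

Lemma tr_unit_1 : tr_1 LP S ∘ tr_unit = id_ D. Proof. apply triple_1. Qed.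

Lemma tr_unit_3 : tr_3 LP S ∘ tr_unit = id_ D. Proof. apply triple_3. Qed.

Lemma triple_pre {Z W : CC} (w : W ~> Z) (x y z : Z ~> D) ed ec ed' ec' :
  triple LP (x := x) (y := y) (z := z) ed ec ∘ w =
  triple LP (x := x ∘ w) (y := y ∘ w) (z := z ∘ w) ed' ec'.
Proof.
  apply tr_joint; rewrite comp_assoc, ?triple_1, ?triple_2, ?triple_3; reflexivity.
Qed.

Lemma triple_ext {Z : CC} (x y z x' y' z' : Z ~> D) ed ec ed' ec' :
  x = x' -> y = y' -> z = z' ->
  triple LP (x := x) (y := y) (z := z) ed ec =
  triple LP (x := x') (y := y') (z := z') ed' ec'.
Proof. intros; subst; f_equal; apply proof_irrelevance. Qed.

Definition tr_graph : RG CC :=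
  {| rg_d := tr_3 LP S; rg_e := tr_unit; rg_c := tr_1 LP S;
     rg_de := tr_unit_3; rg_ce := tr_unit_1 |}.

(** In the graph of triples, the composite of [<z, z, y>] and [<y, x, x>] has the form
    [<z, p, x>], and its middle term [p] is the value of the pregroupoid operation
    at [(x, y, z)]. *)
Section Op.
Variable t : UMGStr LP tr_graph.
Context {Z : CC} {x y z : Z ~> D} (ed : sp_d (sub_ob S) ∘ x = sp_d (sub_ob S) ∘ y)
  (ec : sp_c (sub_ob S) ∘ y = sp_c (sub_ob S) ∘ z).

Lemma tr_composable :
  rg_d tr_graph ∘ triple LP (x := z) (y := z) (z := y) eq_refl (eq_sym ec) =
  rg_c tr_graph ∘ triple LP (x := y) (y := x) (z := x) (eq_sym ed) eq_refl.
Proof. simpl; now rewrite triple_3, triple_1. Qed.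

Definition tr_op : Z ~> D := tr_2 LP S ∘ mul t tr_composable.
End Op.

Lemma tr_graph_op (t : UMGStr LP tr_graph) :
  { p : PreGrpdOp (sub_ob S) |
    forall Z (x y z : Z ~> D) ed ec, op p (x := x) (y := y) (z := z) ed ec = tr_op t ed ec }.
Proof.
  unshelve eexists {| op := fun Z x y z ed ec => tr_op t ed ec |};
    unfold tr_op; try (simpl; reflexivity); intros.
  - rewrite <- comp_assoc; f_equal.
    unshelve refine (eq_trans (mul_pre t (w := w) _ _) _).
    + rewrite !comp_assoc; f_equal; apply tr_composable.
    + apply mul_ext; unshelve erewrite triple_pre; try apply triple_ext; trivial;
        rewrite !comp_assoc; congruence.
  (* For [z = y] the left factor [<y, y, y>] is a unit, so the composite is [<y, x, x>]. *)
  - rewrite mul_unit_l.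
    + apply triple_2.
    + simpl; rewrite triple_1; unfold tr_unit.
      unshelve erewrite triple_pre; try reflexivity.
      apply triple_ext; now rewrite comp_idl.
  (* For [x = y] the right factor [<y, y, y>] is a unit, so the composite is [<z, z, y>]. *)
  - rewrite mul_unit_r.
    + apply triple_2.
    + simpl; rewrite triple_3; unfold tr_unit.
      unshelve erewrite triple_pre; try reflexivity.
      apply triple_ext; now rewrite comp_idl.
  - rewrite comp_assoc, <- tr_d, <- comp_assoc; f_equal.
    refine (eq_trans (mul_c t _) _); apply triple_1.
  - rewrite comp_assoc, tr_c, <- comp_assoc; f_equal.
    refine (eq_trans (mul_d t _) _); apply triple_3.
Qed.
End Triples.

Lemma tr_map_unit (S T : SpanM (@M0 CC)) (h : S ~> T) :
  tr_unit T ∘ sh_D h = tr_map LP h ∘ tr_unit S.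
Proof.
  apply tr_joint; unfold tr_map, tr_unit;
    rewrite !comp_assoc, ?triple_1, ?triple_2, ?triple_3, <- comp_assoc,
      ?triple_1, ?triple_2, ?triple_3, comp_idl, comp_idr; reflexivity.
Qed.

Lemma tr_map_triple (S T : SpanM (@M0 CC)) (h : S ~> T) (Z : CC)
  (x y z : Z ~> sp_D (sub_ob S)) ed ec ed' ec' :
  tr_map LP h ∘ triple LP (x := x) (y := y) (z := z) ed ec =
  triple LP (x := sh_D h ∘ x) (y := sh_D h ∘ y) (z := sh_D h ∘ z) ed' ec'.
Proof.
  apply tr_joint; unfold tr_map;
    rewrite comp_assoc, ?triple_1, ?triple_2, ?triple_3, <- comp_assoc,
      ?triple_1, ?triple_2, ?triple_3; reflexivity.
Qed.

Definition tr_graph_map (S T : SpanM (@M0 CC)) (h : S ~> T) :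
  @Hom (RG CC) (tr_graph S) (tr_graph T) :=
  Build_RGHom (G := tr_graph S) (H := tr_graph T) (rh_1 := tr_map LP h) (rh_0 := sh_D h)
    (triple_3 (S := T) LP (tr_map_d LP h) (tr_map_c LP h))
    (triple_1 (S := T) LP (tr_map_d LP h) (tr_map_c LP h))
    (tr_map_unit h).

(** A span morphism acts on triples termwise and so induces a morphism of graphs; preserving
    composites, it preserves their middle terms. *)
Lemma natural_umg_pregrpd (M : SpanClass CC) :
  Admissible M -> HasNaturalUMG M -> HasNaturalPreGrpd M.
Proof.
  intros HM [t tn].
  pose (U := fun S : SpanM M =>
    {| sub_ob := sub_ob S; sub_in := adm_M0 HM (sub_in S) |} : SpanM (@M0 CC)).
  pose (G := fun S : SpanM M =>
    {| sub_ob := tr_graph (U S); sub_in := adm_tr HM (S := U S) (sub_in S) |}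
      : FullSub (fun G : RG CC => M (rg_span G))).
  exists (fun S => proj1_sig (tr_graph_op (t (G S)))).
  intros S T h Z x y z ed ec ed' ec'.
  rewrite (proj2_sig (tr_graph_op (t (G S)))), (proj2_sig (tr_graph_op (t (G T)))).
  unfold tr_op.
  pose (hU := h : U S ~> U T).
  assert (E := triple_2 (S := U T) LP (tr_map_d LP hU) (tr_map_c LP hU)).
  refine (eq_trans (comp_assoc _ _ _) (eq_trans (f_equal (fun k => k ∘ _) (eq_sym E)) _)).
  rewrite <- comp_assoc; f_equal.
  pose proof (tn (G S) (G T) (tr_graph_map hU)) as tp.
  unshelve refine (eq_trans
    (mul_hom (h := tr_graph_map hU) (tr_composable (S := U S) ed ec) _ tp) _).
  - simpl; rewrite !comp_assoc; unfold tr_map; rewrite triple_1, triple_3, <- !comp_assoc.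
    f_equal; exact (tr_composable (S := U S) ed ec).
  - apply mul_ext; exact (tr_map_triple (h := hU) _ _ _ _).
Qed.
End Kites.

(** * From natural operations to unique kite multiplications *)

Section Conditions.
Context {CC : Category} (LP : LocalProducts CC).

(* [m = p<alpha p1, beta, gamma p2>]. Any solution [m] is a span morphism from [(E, p2, p1)]
   to [(D, d, c)], and the operation of [(E, p2, p1)] sends
   [<e1 p1, e1 p1 e2 p2, e2 p2>] to the identity, so naturality forces uniqueness. *)
Lemma natural_pregrpd_c11 (M : SpanClass CC) :
  Admissible LP M -> HasNaturalPreGrpd M -> CondC11 M.
Proof.
  intros HM [t tn] A C E D D0 D1 p1 e1 p2 e2 al be ga d c jm hD hE h11 h22 hc hb hb' hd hg.
  nrmin hc; nrmin hb; nrmin hb'; nrmin hd; nrmin hg.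
  pose (TD := {| sub_ob := mkSpan d c; sub_in := hD |} : SpanM M).
  pose (TE := {| sub_ob := mkSpan p2 p1; sub_in := adm_sym HM hE |} : SpanM M).
  assert (ed : sp_d (sub_ob TD) ∘ (al ∘ p1) = sp_d (sub_ob TD) ∘ be)
    by (simpl; now rewrite hd, hb).
  assert (ec : sp_c (sub_ob TD) ∘ be = sp_c (sub_ob TD) ∘ (ga ∘ p2))
    by (simpl; now rewrite hg, hb').
  assert (be1 : be ∘ e1 = ga ∘ (p2 ∘ e1)) by (rewrite hb'; nrm; now rw h11).
  assert (be2 : be ∘ e2 = al ∘ (p1 ∘ e2)) by (rewrite <- hb; nrm; now rw h22).
  exists (op (t TD) ed ec); repeat split.
  - refine (eq_trans (op_pre_xyy (t TD) ed ec (w := e1) _) _).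
    + now nrm.
    + rw h11; reflexivity.
  - refine (eq_trans (op_pre_yyz (t TD) ed ec (w := e2) _) _).
    + now nrm.
    + rw h22; reflexivity.
  - nrm; apply (op_d (t TD)).
  - nrm; apply (op_c (t TD)).
  - intros m [m1 [m2 [md mc]]].
    pose (h := Build_SpanHom (S := sub_ob TE) (T := sub_ob TD) (sh_D := m) md mc
      : TE ~> TD).
    assert (ed' : sp_d (sub_ob TE) ∘ (e1 ∘ p1) = sp_d (sub_ob TE) ∘ (e1 ∘ (p1 ∘ (e2 ∘ p2))))
      by (simpl; rewrite hc; now rw h22).
    assert (ec' : sp_c (sub_ob TE) ∘ (e1 ∘ (p1 ∘ (e2 ∘ p2))) = sp_c (sub_ob TE) ∘ (e2 ∘ p2))
      by (simpl; now rw h11).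
    assert (u : op (t TE) ed' ec' = id_ E).
    { apply jm; rewrite comp_idr.
      - refine (eq_trans (op_c (t TE) _ _) _); simpl; rw h11; reflexivity.
      - refine (eq_trans (op_d (t TE) _ _) _); simpl; rw h22; reflexivity. }
    assert (ex : m ∘ (e1 ∘ p1) = al ∘ p1) by (rw m1; reflexivity).
    assert (ey : m ∘ (e1 ∘ (p1 ∘ (e2 ∘ p2))) = be) by (rw m1; exact hb).
    assert (ez : m ∘ (e2 ∘ p2) = ga ∘ p2) by (rw m2; reflexivity).
    rewrite <- (comp_idr m), <- u.
    symmetry.
    unshelve refine (eq_trans (tn TE TD h _ _ _ _ _ _ _ _) _); simpl.
    + rewrite ex, ey; exact ed.
    + rewrite ez, ey; exact ec.
    + now apply (op_ext (t TD)).
Qed.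

(** Both composites are [<r, s>]. *)
Lemma lp_unit {A B C E : CC} {S : SplitCospan A B C}
  {p1 : E ~> A} {e1 : A ~> E} {p2 : E ~> C} {e2 : C ~> E} :
  IsLocalProductOf S p1 e1 p2 e2 -> e1 ∘ sc_r S = e2 ∘ sc_s S.
Proof.
  intros [pb [h11 [h21 [h12 h22]]]]; apply (pb_joint pb); nrm.
  - rw h11; rw h12; rw (sc_gs S); reflexivity.
  - rw h21; rw h22; rw (sc_fr S); reflexivity.
Qed.

(** In a local product [e1 p1 e2 p2] and [e2 p2 e1 p1] are the same idempotent [<r, s> f p1] through
    [B]; the map [beta] of (c11) is that of the kite precomposed with [f p1]. *)
Lemma c11_unique_kite_mult (M : SpanClass CC) :
  Admissible LP M -> CondC11 M -> HasUniqueKiteMult M.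
Proof.
  intros HM H A B C E S p1 e1 p2 e2 L D D0 D1 d c hD al ga hr hd hc.
  nrmin hd; nrmin hc.
  assert (hE := adm_lp HM L).
  destruct L as [pb [h11 [h21 [h12 h22]]]].
  assert (cm := pb_comm pb).
  assert (b1 : al ∘ p1 ∘ e2 ∘ p2 = al ∘ (sc_r S ∘ (sc_f S ∘ p1)))
    by (nrm; rw h12; now rewrite cm).
  apply (H A C E D D0 D1 p1 e1 p2 e2 al (al ∘ (sc_r S ∘ (sc_f S ∘ p1)))); trivial.
  - exact (pb_joint pb).
  - apply (pb_joint pb); nrm.
    + rw h11; rw h12; rw h12; rw h21; rw (sc_gs S); now rewrite cm.
    + rw h21; rw h12; rw h22; rw h21; rw (sc_fr S); now rewrite cm.
  - nrm; rw h21; rw hr; reflexivity.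
  - nrm; rw hd; rw h12; rw (eq_sym hr); now rewrite cm.
  - nrm; rw hc; rw h21; rw hr; now rewrite cm.
Qed.

Section Unique.
Variable M : SpanClass CC.
Hypothesis HK : HasUniqueKiteMult M.

(** The kite equations follow from the existence of one multiplication, so comparing two
    multiplications does not require checking them. *)
Lemma kite_mult_unique {A B C E D D0 D1 : CC} {S : SplitCospan A B C}
  {p1 : E ~> A} {e1 : A ~> E} {p2 : E ~> C} {e2 : C ~> E}
  (L : IsLocalProductOf S p1 e1 p2 e2) {d : D ~> D0} {c : D ~> D1}
  (hD : M (mkSpan d c)) (al : A ~> D) (ga : C ~> D) (m m' : E ~> D) :
  IsKiteMult p1 e1 p2 e2 d c al ga m -> IsKiteMult p1 e1 p2 e2 d c al ga m' -> m = m'.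
Proof.
  intros Hm Hm'; assert (H := Hm); destruct H as [m1 [m2 [md mc]]].
  nrmin md; nrmin mc.
  destruct (HK L hD (alpha := al) (gamma := ga)) as [n [_ hu]].
  - rewrite <- m1, <- m2, <- !comp_assoc; f_equal; exact (lp_unit L).
  - destruct L as [_ [_ [h21 _]]]; nrm; rewrite <- h21, <- m1; now rw md.
  - destruct L as [_ [_ [_ [h12 _]]]]; nrm; rewrite <- h12, <- m2; now rw mc.
  - now rewrite <- (hu m Hm), <- (hu m' Hm').
Qed.

(** Both sides multiply the kite with wings [hD ∘ al] and [hD ∘ ga] over the target span. *)
Lemma kite_mult_natural {A B C E A' C' E' D D0 D1 D' D0' D1' : CC}
  {S : SplitCospan A B C}
  {p1 : E ~> A} {e1 : A ~> E} {p2 : E ~> C} {e2 : C ~> E}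
  (L : IsLocalProductOf S p1 e1 p2 e2)
  {p1' : E' ~> A'} {e1' : A' ~> E'} {p2' : E' ~> C'} {e2' : C' ~> E'}
  {d : D ~> D0} {c : D ~> D1} {d' : D' ~> D0'} {c' : D' ~> D1'}
  (hD' : M (mkSpan d' c'))
  {al : A ~> D} {ga : C ~> D} {al' : A' ~> D'} {ga' : C' ~> D'} {m : E ~> D} {m' : E' ~> D'}
  (Hm : IsKiteMult p1 e1 p2 e2 d c al ga m)
  (Hm' : IsKiteMult p1' e1' p2' e2' d' c' al' ga' m')
  {hA : A ~> A'} {hC : C ~> C'} {hE : E ~> E'} {hD : D ~> D'} {h0 : D0 ~> D0'} {h1 : D1 ~> D1'} :
  p1' ∘ hE = hA ∘ p1 -> p2' ∘ hE = hC ∘ p2 -> hE ∘ e1 = e1' ∘ hA -> hE ∘ e2 = e2' ∘ hC ->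
  d' ∘ hD = h0 ∘ d -> c' ∘ hD = h1 ∘ c -> al' ∘ hA = hD ∘ al -> ga' ∘ hC = hD ∘ ga ->
  hD ∘ m = m' ∘ hE.
Proof.
  intros q1 q2 q3 q4 qd qc qa qg.
  destruct Hm as [m1 [m2 [md mc]]], Hm' as [m1' [m2' [md' mc']]].
  nrmin md; nrmin mc; nrmin md'; nrmin mc'.
  apply (kite_mult_unique L hD' (al := hD ∘ al) (ga := hD ∘ ga)); repeat split; nrm.
  - now rewrite m1.
  - now rewrite m2.
  - rw qd; rw md; rw qd; reflexivity.
  - rw qc; rw mc; rw qc; reflexivity.
  - rewrite q3; rw m1'; exact qa.
  - rewrite q4; rw m2'; exact qg.
  - rw md'; rewrite q2; rw qg; reflexivity.
  - rw mc'; rewrite q1; rw qa; reflexivity.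
Qed.
End Unique.
End Conditions.

(** * Structures determined by kite multiplications *)

Section Lifts.
Context {CC : Category} (LP : LocalProducts CC).

Lemma lp_map_e1 {A B C A' B' C' : CC} {S : SplitCospan A B C} {S' : SplitCospan A' B' C'}
  {hA : A ~> A'} {hB : B ~> B'} {hC : C ~> C'}
  (ef : sc_f S' ∘ hA = hB ∘ sc_f S) (eg : sc_g S' ∘ hC = hB ∘ sc_g S) :
  sc_s S' ∘ hB = hC ∘ sc_s S -> lp_map LP ef eg ∘ lp_e1 LP S = lp_e1 LP S' ∘ hA.
Proof.
  intros es; destruct (lp_local LP S) as [_ [h11 [h21 _]]].
  destruct (lp_local LP S') as [pb [k11 [k21 _]]].
  apply (pb_joint pb).
  - rw (lp_map_1 LP ef eg); rw h11; rw k11; reflexivity.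
  - rw (lp_map_2 LP ef eg); rw h21; rw k21; rw (eq_sym es); now rewrite ef.
Qed.

Lemma lp_map_e2 {A B C A' B' C' : CC} {S : SplitCospan A B C} {S' : SplitCospan A' B' C'}
  {hA : A ~> A'} {hB : B ~> B'} {hC : C ~> C'}
  (ef : sc_f S' ∘ hA = hB ∘ sc_f S) (eg : sc_g S' ∘ hC = hB ∘ sc_g S) :
  sc_r S' ∘ hB = hA ∘ sc_r S -> lp_map LP ef eg ∘ lp_e2 LP S = lp_e2 LP S' ∘ hC.
Proof.
  intros es; destruct (lp_local LP S) as [_ [_ [_ [h12 h22]]]].
  destruct (lp_local LP S') as [pb [_ [_ [k12 k22]]]].
  apply (pb_joint pb).
  - rw (lp_map_1 LP ef eg); rw h12; rw k12; rw (eq_sym es); now rewrite eg.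
  - rw (lp_map_2 LP ef eg); rw h22; rw k22; reflexivity.
Qed.

Lemma UMGStr_eq (G : RG CC) (s t : UMGStr LP G) : um_m s = um_m t -> s = t.
Proof.
  destruct s, t; simpl; intros; subst; f_equal; apply proof_irrelevance.
Qed.

Lemma MKiteStr_eq (K : @DiKite CC) (s t : MKiteStr LP K) : mk_m s = mk_m t -> s = t.
Proof.
  destruct s, t; simpl; intros; subst; f_equal; apply proof_irrelevance.
Qed.

Lemma PreGrpdStr_eq (S : SpanM (@M0 CC)) (s t : PreGrpdStr LP S) : pg_p s = pg_p t -> s = t.
Proof.
  destruct s, t; simpl; intros; subst; f_equal; apply proof_irrelevance.
Qed.

Notation IsChosenKiteMult S := 
  (IsKiteMult (lp_1 LP S) (lp_e1 LP S) (lp_2 LP S) (lp_e2 LP S)).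

Lemma umg_kite (G : RG CC) (s : UMGStr LP G) :
  IsChosenKiteMult (rg_cospan G) (rg_d G) (rg_c G) (id_ (rg_C1 G)) (id_ (rg_C1 G)) (um_m s).
Proof.
  repeat split; nrm; [apply um_e1 | apply um_e2 | apply um_dm | apply um_cm].
Qed.

Lemma kite_umg (G : RG CC) m :
  IsChosenKiteMult (rg_cospan G) (rg_d G) (rg_c G) (id_ (rg_C1 G)) (id_ (rg_C1 G)) m ->
  exists s : UMGStr LP G, um_m s = m.
Proof.
  intros [m1 [m2 [md mc]]]; nrmin md; nrmin mc.
  now exists (Build_UMGStr md mc m1 m2).
Qed.

Lemma mkite_kite (K : @DiKite CC) (s : MKiteStr LP K) :
  IsChosenKiteMult (dk_cospan K) (sp_d (dk_span K)) (sp_c (dk_span K))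
    (dk_alpha K) (dk_gamma K) (mk_m s).
Proof. repeat split; [apply mk_e1 | apply mk_e2 | apply mk_dm | apply mk_cm]. Qed.

Lemma kite_mkite (K : @DiKite CC) m :
  IsChosenKiteMult (dk_cospan K) (sp_d (dk_span K)) (sp_c (dk_span K))
    (dk_alpha K) (dk_gamma K) m ->
  exists s : MKiteStr LP K, mk_m s = m.
Proof. intros [m1 [m2 [md mc]]]; now exists (Build_MKiteStr md mc m1 m2). Qed.

Section PreGrpd.
Variable S : SpanM (@M0 CC).
Notation Kd := (chosen_kernel_pair (proj1 (sub_in S))).
Notation Kc := (chosen_kernel_pair (proj2 (sub_in S))).

(** In the object of triples, built over [D] from the two kernel pairs, [e1] sends [<x, y>] to
    [<x, y, y>] and [e2] sends [<y, z>] to [<y, y, z>]; the Mal'tsev equations are thus the unit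
    equations of a kite. *)
Lemma pregrpd_kite (s : PreGrpdStr LP S) :
  IsChosenKiteMult (tr_cospan S) (sp_d (sub_ob S)) (sp_c (sub_ob S))
    (pb_1 Kd) (pb_2 Kc) (pg_p s).
Proof.
  destruct (lp_local LP (tr_cospan S)) as [pb [h11 [h21 [h12 h22]]]].
  repeat split.
  - rewrite <- (pg_xyy s (pb_comm (pb_is Kd))); f_equal.
    apply tr_joint; rewrite ?triple_1, ?triple_2, ?triple_3.
    + unfold tr_1, tr_ob; rw h11; reflexivity.
    + unfold tr_2, tr_ob; rw h11; reflexivity.
    + unfold tr_3, tr_ob; rw h21; simpl; unfold kp_diag;
        rw (pair_2 (pb_is Kc) (eq_refl (sp_c (sub_ob S) ∘ id_ _))); reflexivity.
  - rewrite <- (pg_yyz s (pb_comm (pb_is Kc))); f_equal.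
    apply tr_joint; rewrite ?triple_1, ?triple_2, ?triple_3.
    + unfold tr_1, tr_ob; rw h12; simpl; unfold kp_diag;
        rw (pair_1 (pb_is Kd) (eq_refl (sp_d (sub_ob S) ∘ id_ _))); reflexivity.
    + rewrite tr_2_alt; unfold tr_ob; rw h22; reflexivity.
    + unfold tr_3, tr_ob; rw h22; reflexivity.
  - refine (eq_trans (pg_d s) _); apply comp_assoc.
  - refine (eq_trans (pg_c s) _); apply comp_assoc.
Qed.

Lemma kite_pregrpd m :
  IsChosenKiteMult (tr_cospan S) (sp_d (sub_ob S)) (sp_c (sub_ob S))
    (pb_1 Kd) (pb_2 Kc) m ->
  exists s : PreGrpdStr LP S, pg_p s = m.
Proof.
  destruct (lp_local LP (tr_cospan S)) as [pb [h11 [h21 [h12 h22]]]].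
  intros [m1 [m2 [md mc]]]; nrmin md; nrmin mc.
  unshelve eexists {| pg_p := m |}; try reflexivity; trivial.
  - intros Z x y e.
    transitivity (m ∘ (lp_e1 LP (tr_cospan S) ∘ pair (pb_is Kd) e)).
    + f_equal; apply tr_joint; rewrite ?triple_1, ?triple_2, ?triple_3.
      * unfold tr_1, tr_ob; rw h11; symmetry; apply pair_1.
      * unfold tr_2, tr_ob; rw h11; symmetry; apply pair_2.
      * unfold tr_3, tr_ob; rw h21; simpl; unfold kp_diag;
        rw (pair_2 (pb_is Kc) (eq_refl (sp_c (sub_ob S) ∘ id_ _))).
        symmetry; apply pair_2.
    + rw m1; apply pair_1.
  - intros Z y z e.
    transitivity (m ∘ (lp_e2 LP (tr_cospan S) ∘ pair (pb_is Kc) e)).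
    + f_equal; apply tr_joint; rewrite ?triple_1, ?triple_2, ?triple_3.
      * unfold tr_1, tr_ob; rw h12; simpl; unfold kp_diag;
        rw (pair_1 (pb_is Kd) (eq_refl (sp_d (sub_ob S) ∘ id_ _))).
        symmetry; apply pair_1.
      * rewrite tr_2_alt; unfold tr_ob; rw h22; symmetry; apply pair_1.
      * unfold tr_3, tr_ob; rw h22; symmetry; apply pair_2.
    + rw m2; apply pair_2.
Qed.
End PreGrpd.

Section Over.
Variable M : SpanClass CC.
Hypothesis HK : HasUniqueKiteMult M.

Lemma umg_unique (G : RG CC) : M (rg_span G) -> forall s t : UMGStr LP G, s = t.
Proof.
  intros hG s t; apply UMGStr_eq.
  exact (kite_mult_unique HK (lp_local LP (rg_cospan G)) hG (umg_kite s) (umg_kite t)).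
Qed.

Lemma umg_lifts : UniquelyLiftsOver (UMG_RG LP) (fun G => M (rg_span G)).
Proof.
  apply forgetF_lifts.
  - intros G hG.
    destruct (HK (lp_local LP (rg_cospan G)) hG (alpha := id_ (rg_C1 G))
      (gamma := id_ (rg_C1 G))) as [m [Hm _]]; simpl; nrm; trivial.
    + rw (rg_de G); reflexivity.
    + rw (rg_ce G); reflexivity.
    + destruct (kite_umg Hm) as [s _]; now exists s.
  - exact umg_unique.
  - intros G H _ hH s t h.
    apply (kite_mult_natural HK (lp_local LP (rg_cospan G)) hH (umg_kite s) (umg_kite t)
      (hA := rh_1 h) (hC := rh_1 h) (h0 := rh_0 h) (h1 := rh_0 h)).
    + apply lp_map_1.
    + apply lp_map_2.
    + apply (lp_map_e1 (S := rg_cospan G) (S' := rg_cospan H)), rh_e.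
    + apply (lp_map_e2 (S := rg_cospan G) (S' := rg_cospan H)), rh_e.
    + apply rh_d.
    + apply rh_c.
    + now nrm.
    + now nrm.
Qed.

Lemma mkite_lifts : UniquelyLiftsOver (MKite_DiKite LP) (fun K => M (dk_span K)).
Proof.
  apply forgetF_lifts.
  - intros K hK; rewrite <- span_eta in hK.
    pose proof (dk_alpha_r K) as ar; pose proof (dk_gamma_s K) as gs.
    pose proof (dk_d K) as kd; pose proof (dk_c K) as kc.
    destruct (HK (lp_local LP (dk_cospan K)) hK (alpha := dk_alpha K)
      (gamma := dk_gamma K)) as [m [Hm _]].
    + congruence.
    + rewrite kd, <- gs; now nrm.
    + rewrite <- kc, <- ar; now nrm.
    + destruct (kite_mkite Hm) as [s _]; now exists s.
  - intros K hK s t; rewrite <- span_eta in hK; apply MKiteStr_eq.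
    exact (kite_mult_unique HK (lp_local LP (dk_cospan K)) hK (mkite_kite s) (mkite_kite t)).
  - intros K L _ hL s t h; rewrite <- span_eta in hL.
    apply (kite_mult_natural HK (lp_local LP (dk_cospan K)) hL (mkite_kite s) (mkite_kite t)
      (hA := kh_A h) (hC := kh_C h) (h0 := sh_0 (kh_span h)) (h1 := sh_1 (kh_span h))).
    + apply lp_map_1.
    + apply lp_map_2.
    + apply lp_map_e1, kh_s.
    + apply lp_map_e2, kh_r.
    + apply sh_d.
    + apply sh_c.
    + apply kh_alpha.
    + apply kh_gamma.
Qed.

Lemma pregrpd_lifts : (forall S, M S -> M0 S) -> UniquelyLiftsOver (PreGrpd_Span LP) M.
Proof.
  intros HM; apply lifts_incl; [exact HM | apply forgetF_lifts].
  - intros S hS; rewrite <- span_eta in hS.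
    pose proof (pb_comm (pb_is (chosen_kernel_pair (proj1 (sub_in S))))) as kd.
    pose proof (pb_comm (pb_is (chosen_kernel_pair (proj2 (sub_in S))))) as kc.
    destruct (HK (lp_local LP (tr_cospan S)) hS
      (alpha := pb_1 (chosen_kernel_pair (proj1 (sub_in S))))
      (gamma := pb_2 (chosen_kernel_pair (proj2 (sub_in S))))) as [m [Hm _]]; simpl.
    + unfold kp_diag; now rewrite pair_1, pair_2.
    + unfold kp_diag; rewrite <- (comp_assoc _ (pb_2 _)), pair_2, comp_idr; exact kd.
    + unfold kp_diag; rewrite <- (comp_assoc _ (pb_1 _)), pair_1, comp_idr; now symmetry.
    + destruct (kite_pregrpd Hm) as [s _]; now exists s.
  - intros S hS s t; rewrite <- span_eta in hS; apply PreGrpdStr_eq.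
    exact (kite_mult_unique HK (lp_local LP (tr_cospan S)) hS
      (pregrpd_kite s) (pregrpd_kite t)).
  - intros S T _ hT s t h; rewrite <- span_eta in hT.
    assert (ed : sp_d (sub_ob T) ∘ (sh_D h ∘ pb_1 (chosen_kernel_pair (proj1 (sub_in S)))) =
      sp_d (sub_ob T) ∘ (sh_D h ∘ pb_2 (chosen_kernel_pair (proj1 (sub_in S)))))
      by (rw (sh_d h); rw (sh_d h);
          now rewrite (pb_comm (pb_is (chosen_kernel_pair (proj1 (sub_in S)))))).
    assert (ec : sp_c (sub_ob T) ∘ (sh_D h ∘ pb_1 (chosen_kernel_pair (proj2 (sub_in S)))) =
      sp_c (sub_ob T) ∘ (sh_D h ∘ pb_2 (chosen_kernel_pair (proj2 (sub_in S)))))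
      by (rw (sh_c h); rw (sh_c h);
          now rewrite (pb_comm (pb_is (chosen_kernel_pair (proj2 (sub_in S)))))).
    pose (hA := pair (pb_is (chosen_kernel_pair (proj1 (sub_in T)))) ed).
    pose (hC := pair (pb_is (chosen_kernel_pair (proj2 (sub_in T)))) ec).
    assert (ef : sc_f (tr_cospan T) ∘ hA = sh_D h ∘ sc_f (tr_cospan S)) by apply pair_2.
    assert (eg : sc_g (tr_cospan T) ∘ hC = sh_D h ∘ sc_g (tr_cospan S)) by apply pair_1.
    assert (er : sc_r (tr_cospan T) ∘ sh_D h = hA ∘ sc_r (tr_cospan S)).
    { simpl; unfold kp_diag.
      apply (pb_joint (pb_is (chosen_kernel_pair (proj1 (sub_in T))))); unfold hA;
        rewrite !comp_assoc, ?pair_1, ?pair_2, <- comp_assoc, ?pair_1, ?pair_2;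
        now nrm. }
    assert (es : sc_s (tr_cospan T) ∘ sh_D h = hC ∘ sc_s (tr_cospan S)).
    { simpl; unfold kp_diag.
      apply (pb_joint (pb_is (chosen_kernel_pair (proj2 (sub_in T))))); unfold hC;
        rewrite !comp_assoc, ?pair_1, ?pair_2, <- comp_assoc, ?pair_1, ?pair_2;
        now nrm. }
    (* Preservation is stated with the map of triples, naturality with the map of local products
       induced on the kernel pairs by [hA] and [hC]; the two agree. *)
    assert (E : tr_map LP h = lp_map LP ef eg).
    { apply tr_joint; unfold tr_map; rewrite ?triple_1, ?triple_2, ?triple_3;
        unfold tr_1, tr_2, tr_3, tr_ob.
      - rw (lp_map_1 LP ef eg).
        rw (pair_1 (pb_is (chosen_kernel_pair (proj1 (sub_in T)))) ed); reflexivity.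
      - rw (lp_map_1 LP ef eg).
        rw (pair_2 (pb_is (chosen_kernel_pair (proj1 (sub_in T)))) ed); reflexivity.
      - rw (lp_map_2 LP ef eg).
        rw (pair_2 (pb_is (chosen_kernel_pair (proj2 (sub_in T)))) ec); reflexivity. }
    simpl; unfold pregrpd_pres; rewrite E.
    apply (kite_mult_natural HK (lp_local LP (tr_cospan S)) hT
      (pregrpd_kite s) (pregrpd_kite t)
      (hA := hA) (hC := hC) (h0 := sh_0 h) (h1 := sh_1 h)).
    + apply lp_map_1.
    + apply lp_map_2.
    + now apply lp_map_e1.
    + now apply lp_map_e2.
    + apply sh_d.
    + apply sh_c.
    + apply pair_1.
    + apply pair_2.
Qed.

Lemma umg_assoc (G : RG CC) (s : UMGStr LP G) : M (rg_span G) -> IsAssociative s.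
Proof.
  intros hG.
  destruct (lp_local LP (rg_cospan G)) as [pb [k11 [k21 [k12 k22]]]]; simpl in k11, k21, k12, k22.
  (* The local product of composable triples, over the object of middle arrows: both
     bracketings multiply the kite with both wings equal to [m]. *)
  pose (Q := {| sc_f := lp_2 LP (rg_cospan G); sc_r := lp_e2 LP (rg_cospan G);
                sc_g := lp_1 LP (rg_cospan G); sc_s := lp_e1 LP (rg_cospan G);
                sc_fr := k22; sc_gs := k11 |}).
  assert (L := lp_local LP Q); assert (L' := L).
  destruct L as [qb [h11 [h21 [h12 h22]]]]; simpl in h11, h21, h12, h22.
  assert (cP := pb_comm pb); assert (cQ := pb_comm qb); simpl in cP, cQ.
  assert (el : rg_d G ∘ (um_m s ∘ lp_1 LP Q) = rg_c G ∘ (lp_2 LP (rg_cospan G) ∘ lp_2 LP Q))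
    by (rw (um_dm s); rewrite cQ; rw cP; reflexivity).
  assert (er : rg_d G ∘ (lp_1 LP (rg_cospan G) ∘ lp_1 LP Q) = rg_c G ∘ (um_m s ∘ lp_2 LP Q))
    by (rw (um_cm s); rw cP; now rewrite cQ).
  assert (E : mul s el = mul s er).
  { apply (kite_mult_unique HK L' hG (al := um_m s) (ga := um_m s)); repeat split; nrm.
    - rewrite mul_pre_unit_r; nrm; [now rw h11|].
      rw h21; rw h11; rw k21; now rw (um_dm s).
    - apply mul_pre_proj; nrm; [|now rw h22].
      rw h12; rw (um_e2 s); reflexivity.
    - refine (eq_trans (mul_d s el) _); rw (um_dm s); reflexivity.
    - exact (mul_c s el).
    - apply mul_pre_proj; nrm; [now rw h11|].
      rw h21; rw (um_e1 s); reflexivity.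
    - rewrite mul_pre_unit_l; nrm; [now rw h22|].
      rw h12; rw h22; rw k12; now rw (um_cm s).
    - exact (mul_d s er).
    - refine (eq_trans (mul_c s er) _); rw (um_cm s); reflexivity. }
  intros Z x y z exy eyz.
  (* The pairs [<x, y>] and [<y, z>] share the middle arrow, so they define a point of the local
     product, along which the generic equation [E] is evaluated. *)
  pose (w := pair qb (x := lp_pair LP (S := rg_cospan G) exy)
    (y := lp_pair LP (S := rg_cospan G) eyz)
    (eq_trans (pair_2 (lp_is LP (rg_cospan G)) exy)
      (eq_sym (pair_1 (lp_is LP (rg_cospan G)) eyz)))).
  assert (w1 : lp_1 LP Q ∘ w = lp_pair LP (S := rg_cospan G) exy) by apply pair_1.
  assert (w2 : lp_2 LP Q ∘ w = lp_pair LP (S := rg_cospan G) eyz) by apply pair_2.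
  transitivity (mul s el ∘ w).
  - symmetry; unshelve refine (eq_trans (mul_pre s (w := w) _ _) _).
    + now rewrite !(comp_assoc _ _ w), el.
    + apply mul_ext; nrm; rewrite ?w1, ?w2; [reflexivity | apply pair_2].
  - rewrite E; unshelve refine (eq_trans (mul_pre s (w := w) _ _) _).
    + now rewrite !(comp_assoc _ _ w), er.
    + apply mul_ext; nrm; rewrite ?w1, ?w2; [apply pair_1 | reflexivity].
Qed.
(* With [i = p<ed, 1, ec>], both [m<i y, w>] and [p<ed y, y, w>] multiply a kite over
   the kernel pair of [c], and both [m<w, i y>] and [p<w, y, ec y>] one over the kernel
   pair of [d]. *)
Lemma umg_inverses (G : RG CC) (s : UMGStr LP G) :
  PreGrpdOp (rg_span G) -> M (rg_span G) -> HasInverses s.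
Proof.
  intros p hG.
  assert (de := rg_de G); assert (ce := rg_ce G).
  assert (ed : rg_d G ∘ (rg_e G ∘ rg_d G) = rg_d G ∘ id_ (rg_C1 G)) by (rw de; reflexivity).
  assert (ec : rg_c G ∘ id_ (rg_C1 G) = rg_c G ∘ (rg_e G ∘ rg_c G)) by (rw ce; reflexivity).
  pose (i := op p (x := rg_e G ∘ rg_d G) (y := id_ (rg_C1 G)) (z := rg_e G ∘ rg_c G) ed ec).
  assert (di : rg_d G ∘ i = rg_c G)
    by (refine (eq_trans (op_d p _ _) _); simpl; rw de; reflexivity).
  assert (ci : rg_c G ∘ i = rg_d G)
    by (refine (eq_trans (op_c p _ _) _); simpl; rw ce; reflexivity).
  assert (ie : i ∘ rg_e G = rg_e G).
  { refine (eq_trans (op_pre_xyy p ed ec _) _); simpl.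
    - rw ce; reflexivity.
    - rw de; reflexivity. }
  exists i, di, ci; split.
  - pose (Q := {| sc_f := rg_d G; sc_r := rg_e G; sc_g := rg_d G; sc_s := rg_e G;
                  sc_fr := de; sc_gs := de |}).
    assert (L := lp_local LP Q); assert (L' := L).
    destruct L as [qb [h11 [h21 [h12 h22]]]]; simpl in h11, h21, h12, h22.
    assert (cm := pb_comm qb); simpl in cm.
    assert (e1 : rg_d G ∘ lp_1 LP Q = rg_c G ∘ (i ∘ lp_2 LP Q)) by now rw ci.
    assert (e2 : rg_c G ∘ lp_2 LP Q = rg_c G ∘ (rg_e G ∘ (rg_c G ∘ lp_2 LP Q)))
      by (rw ce; reflexivity).
    assert (E : mul s e1 = op p cm e2).
    { apply (kite_mult_unique HK L' hG (al := id_ _) (ga := i)); repeat split; nrm.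
      - rewrite mul_pre_unit_r; nrm; [exact h11|].
        rw h21; rw ie; rw h11; reflexivity.
      - rewrite mul_pre_unit_l; nrm; [now rw h22|].
        rw h22; rw ci; exact h12.
      - refine (eq_trans (mul_d s e1) _); now nrm.
      - exact (mul_c s e1).
      - refine (eq_trans (op_pre_xyy p cm e2 _) h11); simpl; nrm.
        rw h21; rw ce; reflexivity.
      - unshelve refine (eq_trans (op_pre p (w := lp_e2 LP Q) cm e2 _ _) (op_ext p _ _ _ _ _ _ _)).
        + simpl; now rewrite !(comp_assoc _ _ (lp_e2 LP Q)), cm.
        + simpl; nrm; rw h22; rw ce; reflexivity.
        + exact h12.
        + exact h22.
        + nrm; rw h22; reflexivity.
      - refine (eq_trans (op_d p cm e2) _); simpl; rw de; now rw di.
      - exact (op_c p cm e2). }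
    (* On the diagonal of the kernel pair the two sides of [E] become [m<1, i>] and
       [p<1, 1, ec> = ec]. *)
    pose (w := pair qb (eq_refl : sc_f Q ∘ id_ _ = sc_g Q ∘ id_ _)).
    assert (w1 : lp_1 LP Q ∘ w = id_ _) by apply pair_1.
    assert (w2 : lp_2 LP Q ∘ w = id_ _) by apply pair_2.
    transitivity (mul s e1 ∘ w).
    + symmetry; unshelve refine (eq_trans (mul_pre s (w := w) _ _) _).
      * now rewrite !(comp_assoc _ _ w), e1.
      * apply mul_ext; nrm; rewrite ?w1, ?w2; now nrm.
    + rewrite E; refine (eq_trans (op_pre_yyz p cm e2 (w := w) _) _).
      * exact (eq_trans w1 (eq_sym w2)).
      * nrm; rw w2; reflexivity.
  - pose (Q := {| sc_f := rg_c G; sc_r := rg_e G; sc_g := rg_c G; sc_s := rg_e G;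
                  sc_fr := ce; sc_gs := ce |}).
    assert (L := lp_local LP Q); assert (L' := L).
    destruct L as [qb [h11 [h21 [h12 h22]]]]; simpl in h11, h21, h12, h22.
    assert (cm := pb_comm qb); simpl in cm.
    assert (e1 : rg_d G ∘ (i ∘ lp_1 LP Q) = rg_c G ∘ lp_2 LP Q) by now rw di.
    assert (e2 : rg_d G ∘ (rg_e G ∘ (rg_d G ∘ lp_1 LP Q)) = rg_d G ∘ lp_1 LP Q)
      by (rw de; reflexivity).
    assert (E : mul s e1 = op p e2 cm).
    { apply (kite_mult_unique HK L' hG (al := i) (ga := id_ _)); repeat split; nrm.
      - rewrite mul_pre_unit_r; nrm; [now rw h11|].
        rw h11; rw di; exact h21.
      - rewrite mul_pre_unit_l; nrm; [exact h22|].
        rw h12; rw ie; rw h22; reflexivity.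
      - exact (mul_d s e1).
      - refine (eq_trans (mul_c s e1) _); now nrm.
      - unshelve refine (eq_trans (op_pre p (w := lp_e1 LP Q) e2 cm _ _) (op_ext p _ _ _ _ _ _ _)).
        + simpl; nrm; rw h11; rw de; reflexivity.
        + simpl; now rewrite !(comp_assoc _ _ (lp_e1 LP Q)), cm.
        + nrm; rw h11; reflexivity.
        + exact h11.
        + exact h21.
      - refine (eq_trans (op_pre_yyz p e2 cm _) h22); simpl; nrm.
        rw h12; rw de; reflexivity.
      - exact (op_d p e2 cm).
      - refine (eq_trans (op_c p e2 cm) _); simpl; rw ce; now rw ci. }
    (* Here the diagonal yields [m<i, 1>] and [p<ed, 1, 1> = ed]. *)
    pose (w := pair qb (eq_refl : sc_f Q ∘ id_ _ = sc_g Q ∘ id_ _)).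
    assert (w1 : lp_1 LP Q ∘ w = id_ _) by apply pair_1.
    assert (w2 : lp_2 LP Q ∘ w = id_ _) by apply pair_2.
    transitivity (mul s e1 ∘ w).
    + symmetry; unshelve refine (eq_trans (mul_pre s (w := w) _ _) _).
      * now rewrite !(comp_assoc _ _ w), e1.
      * apply mul_ext; nrm; rewrite ?w1, ?w2; now nrm.
    + rewrite E; refine (eq_trans (op_pre_xyy p e2 cm (w := w) _) _).
      * exact (eq_trans w1 (eq_sym w2)).
      * nrm; rw w1; reflexivity.
Qed.

Lemma cat_lifts : UniquelyLiftsOver (Cat_RG LP) (fun G => M (rg_span G)).
Proof.
  apply (lifts_full_sub umg_lifts); intros G hG; now apply umg_assoc.
Qed.

Lemma grpd_lifts (hp : forall S, M S -> exists p : PreGrpdOp S, True) :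
  UniquelyLiftsOver (Grpd_RG LP) (fun G => M (rg_span G)).
Proof.
  apply (lifts_full_sub cat_lifts); intros G hG.
  destruct (hp _ hG) as [p _]; exact (umg_inverses (the_str (sub_ob G)) p hG).
Qed.
End Over.
End Lifts.

(** * Equivalence of (c1)-(c11) for an admissible class *)

Section Equivalence.
Context {CC : Category} (LP : LocalProducts CC).

(** Rewriting with the equality of functors inside a statement that mentions the functor as a whole
    replaces objects and morphisms simultaneously, so no structure has to be transported by hand. *)
Lemma section_family (X Y : Category) (F : Functor X Y) (V : Y -> Type)
  (R : forall A B : Y, V A -> V B -> A ~> B -> Prop) (v : forall x : X, V (F x)) :
  (forall (x x' : X) (f : x ~> x'), R _ _ (v x) (v x') (fmor F f)) -> HasSection F ->
  exists t : forall y : Y, V y, forall (A B : Y) (h : A ~> B), R _ _ (t A) (t B) h.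
Proof.
  intros hv [S e].
  assert (H : exists t : forall y, V (compF F S y),
    forall (A B : Y) (h : A ~> B), R _ _ (t A) (t B) (fmor (compF F S) h)).
  { exists (fun y => v (S y)); intros A B h; exact (hv _ _ (fmor S h)). }
  revert H; rewrite e; trivial.
Qed.

Lemma pregrpd_str_op (S : SpanM (@M0 CC)) (s : PreGrpdStr LP S) :
  { p : PreGrpdOp (sub_ob S) | forall Z (x y z : Z ~> sp_D (sub_ob S)) ed ec,
      op p (x := x) (y := y) (z := z) ed ec = pg_p s ∘ triple LP ed ec }.
Proof.
  unshelve eexists {| op := fun Z x y z ed ec => pg_p s ∘ triple LP ed ec |};
    try (simpl; reflexivity); intros.
  - refine (eq_trans (eq_sym (comp_assoc _ _ _)) _); f_equal; apply triple_pre.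
  - rewrite (proof_irrelevance _ ec eq_refl); apply pg_xyy.
  - rewrite (proof_irrelevance _ ed eq_refl); apply pg_yyz.
  - refine (eq_trans (comp_assoc _ _ _) _).
    refine (eq_trans (f_equal (fun k => k ∘ _) (pg_d s)) _).
    rewrite <- comp_assoc; f_equal; apply triple_3.
  - refine (eq_trans (comp_assoc _ _ _) _).
    refine (eq_trans (f_equal (fun k => k ∘ _) (pg_c s)) _).
    rewrite <- comp_assoc; f_equal; apply triple_1.
Qed.

Lemma section_natural_pregrpd (M : SpanClass CC) :
  HasSection (PreGrpdM_SpanM LP M) -> HasNaturalPreGrpd M.
Proof.
  intros H.
  pose (v := fun x : FullSub (fun S : PreGrpd LP => M (PreGrpd_Span LP S)) =>
    proj1_sig (pregrpd_str_op (the_str (sub_ob x)))).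
  apply (section_family (F := PreGrpdM_SpanM LP M) (V := fun S => PreGrpdOp (sub_ob S))
    (R := fun A B s t h => forall Z (x y z : Z ~> sp_D (sub_ob A)) ed ec ed' ec',
      sh_D h ∘ op s (x := x) (y := y) (z := z) ed ec =
      op t (x := sh_D h ∘ x) (y := sh_D h ∘ y) (z := sh_D h ∘ z) ed' ec')
    (v := v)); [|exact H].
  intros S T h Z x y z ed ec ed' ec'; unfold v; simpl in *.
  refine (eq_trans (f_equal _ (proj2_sig (pregrpd_str_op _) _ _ _ _ _ _)) _).
  refine (eq_trans _ (eq_sym (proj2_sig (pregrpd_str_op _) _ _ _ _ _ _))).
  pose proof (under_pres h) as hp; simpl in hp; unfold pregrpd_pres in hp.
  refine (eq_trans (comp_assoc _ _ _) (eq_trans (f_equal (fun k => k ∘ _) hp) _)).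
  rewrite <- comp_assoc; f_equal; exact (tr_map_triple LP (h := under_mor h) _ _ _ _).
Qed.

(** A composition on [G] is a multiplication of this kite, so a section over kites restricts to
    natural compositions on graphs. *)
Definition graph_kite (G : RG CC) : @DiKite CC.
Proof.
  refine {| dk_cospan := rg_cospan G; dk_span := rg_span G; dk_alpha := id_ (rg_C1 G);
            dk_beta := rg_e G; dk_gamma := id_ (rg_C1 G) : rg_C1 G ~> sp_D (rg_span G) |};
    simpl; nrm; trivial.
  - rw (rg_de G); reflexivity.
  - rw (rg_ce G); reflexivity.
Defined.

Definition graph_kite_map (G H : RG CC) (h : G ~> H) : graph_kite G ~> graph_kite H.
Proof.
  unshelve refine (Build_DiKiteHom (K := graph_kite G) (L := graph_kite H)
    (kh_span := Build_SpanHom (S := rg_span G) (T := rg_span H) (rh_d h) (rh_c h))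
    (rh_d h) (rh_e h) (rh_c h) (rh_e h) _ (rh_e h) _); simpl; now nrm.
Defined.

Lemma natural_mkite_umg (M : SpanClass CC)
  (t : forall K : FullSub (fun K : @DiKite CC => M (dk_span K)), MKiteStr LP (sub_ob K)) :
  (forall (K L : FullSub (fun K : @DiKite CC => M (dk_span K))) (h : K ~> L),
    mkite_pres (t K) (t L) h) -> HasNaturalUMG LP M.
Proof.
  intros tn.
  pose (k := fun G : FullSub (fun G : RG CC => M (rg_span G)) =>
    {| sub_ob := graph_kite (sub_ob G); sub_in := sub_in G |}
      : FullSub (fun K : @DiKite CC => M (dk_span K))).
  assert (H : forall G, exists s : UMGStr LP (sub_ob G), um_m s = mk_m (t (k G))).
  { intros G; apply (kite_umg (mkite_kite (t (k G)))). }
  exists (fun G => proj1_sig (constructive_indefinite_description _ (H G))).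
  intros G G' h; unfold umg_pres.
  rewrite (proj2_sig (constructive_indefinite_description _ (H G))).
  rewrite (proj2_sig (constructive_indefinite_description _ (H G'))).
  exact (tn (k G) (k G') (graph_kite_map h)).
Qed.

Lemma section_natural_umg (M : SpanClass CC) (X : Category) (F : Functor X (RG CC))
  (v : forall x : X, UMGStr LP (F x)) :
  (forall (x x' : X) (f : x ~> x'), umg_pres (v x) (v x') (fmor F f)) ->
  HasSection (overM F M) -> HasNaturalUMG LP M.
Proof.
  intros hv.
  apply (section_family (F := overM F M) (V := fun G => UMGStr LP (sub_ob G))
    (R := fun A B s t h => umg_pres s t h) (v := fun x => v (sub_ob x))).
  intros x x' f; apply hv.
Qed.

Lemma section_natural_mkite (M : SpanClass CC) :
  HasSection (MKiteM_DiKiteM LP M) -> HasNaturalUMG LP M.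
Proof.
  intros H.
  destruct (section_family (F := MKiteM_DiKiteM LP M) (V := fun K => MKiteStr LP (sub_ob K))
    (R := fun A B s t h => mkite_pres s t h)
    (v := fun x => the_str (sub_ob x)) (fun x x' f => under_pres f) H) as [t tn].
  exact (natural_mkite_umg tn).
Qed.

Lemma unique_kite_mult_pregrpd (M : SpanClass CC) :
  Admissible LP M -> HasUniqueKiteMult M -> HasNaturalPreGrpd M.
Proof.
  intros HM HK; apply section_natural_pregrpd, iso_section, restrictF_iso.
  exact (pregrpd_lifts LP HK (adm_M0 HM)).
Qed.

Lemma natural_pregrpd_kite_mult (M : SpanClass CC) :
  Admissible LP M -> HasNaturalPreGrpd M -> HasUniqueKiteMult M.
Proof.
  intros HM H; apply (c11_unique_kite_mult HM), (natural_pregrpd_c11 HM H).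
Qed.

Lemma natural_pregrpd_exists (M : SpanClass CC) :
  HasNaturalPreGrpd M -> forall S, M S -> exists p : PreGrpdOp S, True.
Proof.
  intros [t _] S hS; now exists (t {| sub_ob := S; sub_in := hS |} : PreGrpdOp S).
Qed.

Lemma grpd_lifts_natural (M : SpanClass CC) :
  Admissible LP M -> HasNaturalPreGrpd M ->
  UniquelyLiftsOver (Grpd_RG LP) (fun G => M (rg_span G)).
Proof.
  intros HM H; apply (grpd_lifts LP (natural_pregrpd_kite_mult HM H)).
  now apply natural_pregrpd_exists.
Qed.

Lemma natural_pregrpd_conditions (M : SpanClass CC) :
  Admissible LP M -> HasNaturalPreGrpd M -> forall k, Condition LP M k.
Proof.
  intros HM H.
  assert (HK := natural_pregrpd_kite_mult HM H).
  assert (C1 : Condition LP M c1) by exact (restrictF_iso (grpd_lifts_natural HM H)).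
  assert (C3 : Condition LP M c3) by exact (restrictF_iso (cat_lifts LP HK)).
  assert (C5 : Condition LP M c5) by exact (restrictF_iso (umg_lifts LP HK)).
  assert (C7 : Condition LP M c7) by exact (restrictF_iso (pregrpd_lifts LP HK (adm_M0 HM))).
  assert (C9 : Condition LP M c9) by exact (restrictF_iso (mkite_lifts LP HK)).
  intros []; trivial; try (apply iso_section; assumption).
  exact (natural_pregrpd_c11 HM H).
Qed.

(** An isomorphism gives a section, and a section into groupoids, categories or kites gives natural
    compositions; these cases thus reduce to unital multiplicative graphs. *)
Lemma condition_natural_pregrpd (M : SpanClass CC) (k : CondIndex) :
  Admissible LP M -> Condition LP M k -> HasNaturalPreGrpd M.
Proof.
  intros HM.
  assert (U := natural_umg_pregrpd HM).
  destruct k; simpl; intros H; try apply iso_section in H.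
  - exact (U (section_natural_umg (F := Grpd_RG LP)
      (v := fun x => the_str (sub_ob (sub_ob x))) (fun x x' f => under_pres f) H)).
  - exact (U (section_natural_umg (F := Grpd_RG LP)
      (v := fun x => the_str (sub_ob (sub_ob x))) (fun x x' f => under_pres f) H)).
  - exact (U (section_natural_umg (F := Cat_RG LP)
      (v := fun x => the_str (sub_ob x)) (fun x x' f => under_pres f) H)).
  - exact (U (section_natural_umg (F := Cat_RG LP)
      (v := fun x => the_str (sub_ob x)) (fun x x' f => under_pres f) H)).
  - exact (U (section_natural_umg (F := UMG_RG LP)
      (v := fun x => the_str x) (fun x x' f => under_pres f) H)).
  - exact (U (section_natural_umg (F := UMG_RG LP)
      (v := fun x => the_str x) (fun x x' f => under_pres f) H)).
  - exact (section_natural_pregrpd H).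
  - exact (section_natural_pregrpd H).
  - exact (U (section_natural_mkite H)).
  - exact (U (section_natural_mkite H)).
  - exact (unique_kite_mult_pregrpd HM (c11_unique_kite_mult HM H)).
Qed.

Lemma conditions_equivalent (M : SpanClass CC) :
  Admissible LP M -> forall i j, Condition LP M i <-> Condition LP M j.
Proof.
  intros HM i j; split; intros H;
    apply (natural_pregrpd_conditions HM (condition_natural_pregrpd HM H)).
Qed.
End Equivalence.

(** * The three classes of spans *)

Section Classes.
Context {CC : Category} (LP : LocalProducts CC).

Lemma M0_local_product {A B C E : CC} {S : SplitCospan A B C}
  {p1 : E ~> A} {e1 : A ~> E} {p2 : E ~> C} {e2 : C ~> E} :
  IsLocalProductOf S p1 e1 p2 e2 -> M0 (mkSpan p1 p2).
Proof.
  intros [_ [h11 [_ [_ h22]]]]; split; simpl.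
  - exact (split_epi_kernel_pair LP h11).
  - exact (split_epi_kernel_pair LP h22).
Qed.

Lemma M0_triples (S : SpanM (@M0 CC)) : M0 (mkSpan (tr_3 LP S) (tr_1 LP S)).
Proof.
  split; simpl.
  - exact (split_epi_kernel_pair LP (tr_unit_3 LP S)).
  - exact (split_epi_kernel_pair LP (tr_unit_1 LP S)).
Qed.

Lemma M0_admissible : Admissible LP M0.
Proof.
  split.
  - trivial.
  - intros D D0 D1 d c [h1 h2]; split; assumption.
  - intros A B C E S p1 e1 p2 e2 L; exact (M0_local_product L).
  - intros S _; apply M0_triples.
Qed.

(** The middle term is determined by the outer ones, since [dy = dx] and [cy = cz]. *)
Lemma triples_jointly_monic (S : SpanM (@M0 CC)) :
  JointlyMonic (sp_d (sub_ob S)) (sp_c (sub_ob S)) ->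
  JointlyMonic (tr_3 LP S) (tr_1 LP S).
Proof.
  intros H Z u v e3 e1.
  assert (td := tr_d LP S); assert (tc := tr_c LP S); simpl in td, tc.
  apply tr_joint; trivial.
  apply H; rewrite !comp_assoc.
  - now rewrite <- td, <- !comp_assoc, e1.
  - now rewrite tc, <- !comp_assoc, e3.
Qed.

Lemma M1_admissible : Admissible LP M1.
Proof.
  split.
  - intros S [h _]; exact h.
  - intros D D0 D1 d c [[h1 h2] h]; split; [split; assumption|].
    intros Z u v eu ev; now apply h.
  - intros A B C E S p1 e1 p2 e2 L; split; [exact (M0_local_product L)|].
    destruct L as [pb _]; exact (pb_joint pb).
  - intros S [_ h]; split; [apply M0_triples | now apply triples_jointly_monic].
Qed.

(** The square formed by [g0] and [g1] commutes because it does so after the epimorphism [q]. *)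
Lemma pullback_jointly_strongly_monic {A B C E : CC} {f : A ~> B} {g : C ~> B}
  {p1 : E ~> A} {p2 : E ~> C} :
  IsPullback f g p1 p2 -> JointlyStronglyMonic p1 p2.
Proof.
  intros pb Z W q hq u g0 g1 e0 e1.
  assert (e : f ∘ g0 = g ∘ g1).
  { apply hq; nrm; rewrite <- e0, <- e1; now rw (pb_comm pb). }
  exists (pair pb e); repeat split.
  - apply (pb_joint pb); rewrite comp_assoc, ?pair_1, ?pair_2; now symmetry.
  - apply pair_1.
  - apply pair_2.
  - intros m [_ [k1 k2]]; apply (pb_joint pb); rewrite ?pair_1, ?pair_2; now symmetry.
Qed.

(** The outer terms extend along [q] as [g1] and [g0]. These prescribe the legs of the middle term,
    which orthogonality of [(d, c)] then extends as well. *)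
Lemma triples_jointly_strongly_monic (S : SpanM (@M0 CC)) :
  JointlyStronglyMonic (sp_d (sub_ob S)) (sp_c (sub_ob S)) ->
  JointlyStronglyMonic (tr_3 LP S) (tr_1 LP S).
Proof.
  intros H Z W q hq u g0 g1 e3 e1.
  assert (td := tr_d LP S); assert (tc := tr_c LP S); simpl in td, tc.
  destruct (H Z W q hq (tr_2 LP S ∘ u) (sp_d (sub_ob S) ∘ g1) (sp_c (sub_ob S) ∘ g0))
    as [m [[m1 [m2 m3]] _]].
  - rewrite comp_assoc, <- td, <- !comp_assoc; now rewrite e1.
  - rewrite comp_assoc, tc, <- !comp_assoc; now rewrite e3.
  - exists (triple LP (eq_sym m2) m3); repeat split.
    + apply tr_joint; rewrite comp_assoc, ?triple_1, ?triple_2, ?triple_3; auto.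
    + apply triple_3.
    + apply triple_1.
    + intros n [n1 _]; apply hq; rewrite n1.
      apply tr_joint; rewrite comp_assoc, ?triple_1, ?triple_2, ?triple_3; auto.
Qed.

Lemma M2_admissible : Admissible LP M2.
Proof.
  split.
  - intros S [h _]; exact h.
  - intros D D0 D1 d c [[h1 h2] h]; split; [split; assumption|].
    intros Z W q hq u g0 g1 e0 e1; simpl in *.
    destruct (h Z W q hq u g1 g0 e1 e0) as [m [[k1 [k2 k3]] hu]].
    exists m; repeat split; trivial.
    intros n [n1 [n2 n3]]; apply hu; auto.
  - intros A B C E S p1 e1 p2 e2 L; split; [exact (M0_local_product L)|].
    destruct L as [pb _]; exact (pullback_jointly_strongly_monic pb).
  - intros S [_ h]; split; [apply M0_triples | now apply triples_jointly_strongly_monic].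
Qed.
End Classes.

(** * Naturally Mal'tsev categories *)

Section NaturallyMaltsev.
Context {CC : Category} (LP : LocalProducts CC).

(** The legs of a reflexive graph are split epimorphisms, so its span always lies in [M0] and the
    Lawvere condition is (c1) for [M0]. *)
Lemma naturally_maltsev_natural_pregrpd :
  NaturallyMaltsevType LP <-> HasNaturalPreGrpd (@M0 CC).
Proof.
  split; intros H.
  - apply iso_section in H.
    apply (natural_umg_pregrpd (M0_admissible LP)).
    destruct (section_family (F := Grpd_RG LP) (V := fun G => UMGStr LP G)
      (R := fun A B s t h => umg_pres s t h) (v := fun x => the_str (sub_ob (sub_ob x)))
      (fun x x' f => under_pres f) H) as [t tn].
    exists (fun G => t (sub_ob G)); intros G G' h; exact (tn _ _ h).
  - apply uniquely_lifts_iso.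
    destruct (grpd_lifts_natural (M0_admissible LP) H) as [a b c d].
    split; intros; [apply a | apply b | apply c | apply d];
      trivial; apply (rg_span_M0 LP).
Qed.

(** Over the span of two maps to the terminal object the constraints on triples are void and every
    [h] is a span morphism; evaluating the operation at the three projections of the cube gives
    [p_D]. *)
Lemma naturally_maltsev_operation (BP : BinaryProducts CC) :
  HasNaturalPreGrpd (@M0 CC) -> HasTerminal CC ->
  exists p : forall D : CC, cube BP D ~> D, IsNaturalMaltsevOperation p.
Proof.
  intros [t tn] [T hT].
  assert (hu : forall (Z : CC) (u v : Z ~> T), u = v).
  { intros Z u v; destruct (hT Z) as [m [_ hm]].
    now rewrite <- (hm u I), <- (hm v I). }
  pose (bang := fun Z => proj1_sig (constructive_indefinite_description _ (hT Z))).
  assert (kp : forall D, HasKernelPair (bang D)).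
  { intros D; constructor.
    refine {| pb_1 := prod_1 BP D D; pb_2 := prod_2 BP D D |}; split.
    - apply hu.
    - intros Z x y _; apply prod_univ. }
  pose (S := fun D => {| sub_ob := mkSpan (bang D) (bang D); sub_in := conj (kp D) (kp D) |}
    : SpanM (@M0 CC)).
  assert (pp1 : forall A B Z (x : Z ~> A) (y : Z ~> B), prod_1 BP A B ∘ prod_pair BP x y = x).
  { intros; unfold prod_pair.
    now destruct constructive_indefinite_description as [m [[h1 h2] h]]. }
  assert (pp2 : forall A B Z (x : Z ~> A) (y : Z ~> B), prod_2 BP A B ∘ prod_pair BP x y = y).
  { intros; unfold prod_pair.
    now destruct constructive_indefinite_description as [m [[h1 h2] h]]. }
  pose (q1 := fun D => prod_1 BP D D ∘ prod_1 BP (prod_ob BP D D) D : cube BP D ~> D).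
  pose (q2 := fun D => prod_2 BP D D ∘ prod_1 BP (prod_ob BP D D) D : cube BP D ~> D).
  pose (q3 := fun D => prod_2 BP (prod_ob BP D D) D : cube BP D ~> D).
  assert (t1 : forall D Z (x y z : Z ~> D), q1 D ∘ cube_triple BP x y z = x).
  { intros; unfold q1, cube_triple, cube; nrm; now rewrite !pp1. }
  assert (t2 : forall D Z (x y z : Z ~> D), q2 D ∘ cube_triple BP x y z = y).
  { intros; unfold q2, cube_triple, cube; nrm; now rewrite pp1, pp2. }
  assert (t3 : forall D Z (x y z : Z ~> D), q3 D ∘ cube_triple BP x y z = z).
  { intros; unfold q3, cube_triple, cube; nrm; now rewrite pp2. }
  exists (fun D => op (t (S D)) (x := q1 D) (y := q2 D) (z := q3 D) (hu _ _ _) (hu _ _ _)).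
  split.
  - intros D D' h.
    pose (hS := Build_SpanHom (S := sub_ob (S D)) (T := sub_ob (S D')) (sh_D := h)
      (sh_0 := id_ T) (sh_1 := id_ T) (hu _ _ _) (hu _ _ _) : S D ~> S D').
    refine (eq_trans (tn (S D) (S D') hS _ _ _ _ _ _ (hu _ _ _) (hu _ _ _)) _).
    refine (eq_trans _ (eq_sym (op_pre (t (S D')) (w := cube_map BP h) _ _
      (hu _ _ _) (hu _ _ _)))).
    apply (op_ext (t (S D'))); symmetry; [apply t1 | apply t2 | apply t3].
  - intros D Z x y; split.
    + refine (eq_trans (op_pre_xyy (t (S D)) _ _ (w := cube_triple BP x y y) _) (t1 _ _ _ _ _)).
      exact (eq_trans (t2 _ _ _ _ _) (eq_sym (t3 _ _ _ _ _))).
    + refine (eq_trans (op_pre_yyz (t (S D)) _ _ (w := cube_triple BP x x y) _) (t3 _ _ _ _ _)).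
      exact (eq_trans (t1 _ _ _ _ _) (eq_sym (t2 _ _ _ _ _))).
Qed.

(* The pushout [Q] of [r] and [s] carries the span of retractions [<1, rg>] and [<sf, 1>],
   and the multiplication of the kite [(i1, i2)] over it inverts [Q ~> E]. *)
Lemma local_product_coproduct :
  HasUniqueKiteMult (@M0 CC) -> HasSplitMonoPushouts CC ->
  forall (A C E : CC) (p1 : E ~> A) (e1 : A ~> E) (p2 : E ~> C) (e2 : C ~> E),
    IsLocalProduct p1 e1 p2 e2 -> IsLocalCoproduct p1 e1 p2 e2.
Proof.
  intros HK HP A C E p1 e1 p2 e2 [B [S L]]; exists B, S; split; trivial.
  destruct (HP B A C (sc_r S) (sc_s S)) as [Q [i1 [i2 [qc qu]]]].
  { exists (sc_f S); apply sc_fr. }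
  { exists (sc_g S); apply sc_gs. }
  assert (fr := sc_fr S); assert (gs := sc_gs S).
  assert (u := lp_unit L).
  assert (qe : forall Z (x y : Q ~> Z), x ∘ i1 = y ∘ i1 -> x ∘ i2 = y ∘ i2 -> x = y).
  { intros Z x y h1 h2.
    destruct (qu Z (y ∘ i1) (y ∘ i2)) as [m [_ hm]].
    - nrm; now rewrite qc.
    - rewrite <- (hm x (conj h1 h2)); now apply hm. }
  destruct (qu A (id_ A) (sc_r S ∘ sc_g S)) as [q1 [[q11 q12] _]].
  { nrm; rw gs; reflexivity. }
  destruct (qu C (sc_s S ∘ sc_f S) (id_ C)) as [q2 [[q21 q22] _]].
  { nrm; rw fr; reflexivity. }
  destruct (qu E e1 e2 u) as [k [[k1 k2] _]].
  (* With [q2] as first leg, the leg equations of a multiplication read [q2 m = p2] and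
     [q1 m = p1]. *)
  assert (hQ : M0 (mkSpan q2 q1)).
  { split; simpl; eapply (split_epi_kernel_pair LP); [exact q22 | exact q11]. }
  destruct (HK _ _ _ _ _ _ _ _ _ L _ _ _ q2 q1 hQ i1 i2 qc) as [m [[m1 [m2 [md mc]]] _]].
  { rewrite q21; rw q22; reflexivity. }
  { rewrite q12; rw q11; reflexivity. }
  nrmin md; nrmin mc.
  destruct L as [pb [h11 [h21 [h12 h22]]]].
  assert (km : k ∘ m = id_ E).
  { assert (a1 : p1 ∘ k = q1).
    { apply qe; nrm; rewrite ?k1, ?k2; congruence. }
    assert (a2 : p2 ∘ k = q2).
    { apply qe; nrm; rewrite ?k1, ?k2; congruence. }
    apply (pb_joint pb).
    - rw a1; rw mc; rw q11; reflexivity.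
    - rw a2; rw md; rw q22; reflexivity. }
  split; [exact u|].
  intros Z x y e; destruct (qu Z x y e) as [n [[n1 n2] hn]].
  (* The equation [k m = 1] suffices: any factorization satisfies [n' = n' k m = n m]. *)
  exists (n ∘ m); split; [split; nrm; congruence|].
  intros n' [l1 l2].
  rewrite (hn (n' ∘ k)); [nrm; rw km; reflexivity|].
  split; nrm; congruence.
Qed.
End NaturallyMaltsev.

(** * Mal'tsev categories *)

Section Maltsev.
Context {CC : Category} (LP : LocalProducts CC).

(* Symmetry of the relation of triples exchanges [x] and [z] in [<x, y, z>], and the
   middle term of the result is the pregroupoid operation. *)
Lemma maltsev_natural_pregrpd : MaltsevType CC -> HasNaturalPreGrpd (@M1 CC).
Proof.
  intros H.
  assert (P : forall S : SpanM (@M1 CC), exists p : PreGrpdOp (sub_ob S), True).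
  { intros [S [h0 hj]].
    pose (U := {| sub_ob := S; sub_in := h0 |} : SpanM (@M0 CC)).
    destruct (H (tr_graph LP U) (triples_jointly_monic (LP := LP) (S := U) hj)) as [i [i1 i2]].
    simpl in i, i1, i2.
    assert (td := tr_d LP U); assert (tc := tr_c LP U); simpl in td, tc.
    pose (p := tr_2 LP U ∘ i).
    assert (pd : sp_d S ∘ p = sp_d S ∘ tr_3 LP U)
      by (unfold p; rewrite comp_assoc, <- td, <- comp_assoc; now rewrite i2).
    assert (pc : sp_c S ∘ p = sp_c S ∘ tr_1 LP U)
      by (unfold p; rewrite comp_assoc, tc, <- comp_assoc; now rewrite i1).
    assert (opd : forall Z (x y z : Z ~> sp_D S) ed ec,
      sp_d S ∘ (p ∘ triple LP (S := U) (x := x) (y := y) (z := z) ed ec) = sp_d S ∘ z).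
    { intros; rewrite comp_assoc, pd, <- comp_assoc; f_equal; exact (triple_3 (S := U) LP ed ec). }
    assert (opc : forall Z (x y z : Z ~> sp_D S) ed ec,
      sp_c S ∘ (p ∘ triple LP (S := U) (x := x) (y := y) (z := z) ed ec) = sp_c S ∘ x).
    { intros; rewrite comp_assoc, pc, <- comp_assoc; f_equal; exact (triple_1 (S := U) LP ed ec). }
    unshelve eexists {| op := fun Z x y z ed ec => p ∘ triple LP (S := U) ed ec |};
      trivial; intros; simpl.
    - rewrite <- comp_assoc; f_equal; apply (triple_pre LP (S := U)).
    - apply hj; rewrite ?opd, ?opc; auto.
    - apply hj; rewrite ?opd, ?opc; auto. }
  exists (fun S => proj1_sig (constructive_indefinite_description _ (P S))).
  intros S T h Z x y z ed ec ed' ec'.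
  (* Naturality is automatic here: the legs of both sides are prescribed, and those of the target
     are jointly monic. *)
  apply (proj2 (sub_in T)).
  - rewrite op_d, comp_assoc, (sh_d h), <- comp_assoc, op_d.
    rewrite !comp_assoc; now rewrite (sh_d h).
  - rewrite op_c, comp_assoc, (sh_c h), <- comp_assoc, op_c.
    rewrite !comp_assoc; now rewrite (sh_c h).
Qed.

(** The symmetry is given by the formula for inverses, [p<ed, 1, ec>]. *)
Lemma natural_pregrpd_maltsev : HasNaturalPreGrpd (@M1 CC) -> MaltsevType CC.
Proof.
  intros [t _] G hG.
  pose (S := {| sub_ob := rg_span G; sub_in := conj (rg_span_M0 LP G) hG |} : SpanM (@M1 CC)).
  assert (ed : rg_d G ∘ (rg_e G ∘ rg_d G) = rg_d G ∘ id_ (rg_C1 G))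
    by (rw (rg_de G); reflexivity).
  assert (ec : rg_c G ∘ id_ (rg_C1 G) = rg_c G ∘ (rg_e G ∘ rg_c G))
    by (rw (rg_ce G); reflexivity).
  exists (op (t S) (x := rg_e G ∘ rg_d G) (y := id_ (rg_C1 G)) (z := rg_e G ∘ rg_c G) ed ec).
  split.
  - refine (eq_trans (op_d (t S) ed ec) _); simpl; rw (rg_de G); reflexivity.
  - refine (eq_trans (op_c (t S) ed ec) _); simpl; rw (rg_ce G); reflexivity.
Qed.

(** Extremality does not ask for [alpha r = gamma s]; over jointly monic legs this follows from the
    two leg equations. *)
Lemma kite_mult_extremal :
  HasUniqueKiteMult (@M1 CC) <->
  forall (A C E : CC) (p1 : E ~> A) (e1 : A ~> E) (p2 : E ~> C) (e2 : C ~> E),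
    IsLocalProduct p1 e1 p2 e2 -> IsExtremal p1 e1 p2 e2.
Proof.
  split.
  - intros HK A C E p1 e1 p2 e2 [B [S L]] D D0 D1 d c hD al ga hd hc.
    nrmin hd; nrmin hc.
    assert (L' := L); destruct L' as [pb [h11 [h21 [h12 h22]]]].
    rewrite h21 in hd; rewrite h12 in hc.
    destruct (HK _ _ _ _ _ _ _ _ _ L _ _ _ d c hD al ga) as [m [[m1 [m2 [md mc]]] hu]].
    + apply (proj2 hD); simpl.
      * rw hd; rw (sc_fr S); reflexivity.
      * rw hc; rw (sc_gs S); reflexivity.
    + now nrm.
    + now nrm.
    + exists m; repeat split; trivial.
      intros n [n1 [n2 [n3 n4]]]; apply hu; repeat split; trivial.
  - intros H A B C E S p1 e1 p2 e2 L D D0 D1 d c hD al ga hr hd hc.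
    nrmin hd; nrmin hc.
    assert (L' := L); destruct L' as [pb [h11 [h21 [h12 h22]]]].
    destruct (H A C E p1 e1 p2 e2 (ex_intro _ B (ex_intro _ S L)) D D0 D1 d c hD al ga)
      as [m [[m1 [m2 [m3 m4]]] hu]].
    + rw h21; exact hd.
    + rw h12; exact hc.
    + exists m; repeat split; trivial.
      intros n [n1 [n2 [n3 n4]]]; apply hu; repeat split; trivial.
Qed.
End Maltsev.

(** * Weakly Mal'tsev categories *)

Section WeaklyMaltsev.
Context {CC : Category} (LP : LocalProducts CC).

Lemma exists_triples_object {D D0 D1 : CC} (d : D ~> D0) (c : D ~> D1) :
  M0 (mkSpan d c) ->
  exists (T : CC) (t1 t2 t3 : T ~> D), d ∘ t1 = d ∘ t2 /\ c ∘ t2 = c ∘ t3 /\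
    forall (Z : CC) (x y z : Z ~> D), d ∘ x = d ∘ y -> c ∘ y = c ∘ z ->
      exists w : Z ~> T, t1 ∘ w = x /\ t2 ∘ w = y /\ t3 ∘ w = z.
Proof.
  intros h.
  pose (U := {| sub_ob := mkSpan d c; sub_in := h |} : SpanM (@M0 CC)).
  exists (tr_ob LP U), (tr_1 LP U), (tr_2 LP U), (tr_3 LP U); repeat split.
  - exact (tr_d LP U).
  - exact (tr_c LP U).
  - intros Z x y z ed ec; exists (triple LP (S := U) ed ec); repeat split.
    + exact (triple_1 LP (S := U) ed ec).
    + exact (triple_2 LP (S := U) ed ec).
    + exact (triple_3 LP (S := U) ed ec).
Qed.

(* The object of [(x, y, w)] with [dx = cy], [dw = dy] and [cw = cx] maps onto the object
   of composable pairs [(x, y)] by an epimorphism, since both unit inclusions factor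
   through it; orthogonality then extends [w] to a multiplication. *)
Lemma weakly_maltsev_umg :
  HasEqualizers CC -> WeaklyMaltsevType CC ->
  UniquelyLiftsOver (UMG_RG LP) (fun G => M2 (rg_span G)).
Proof.
  intros HE HW.
  assert (W : forall G : RG CC, JointlyEpic (lp_e1 LP (rg_cospan G)) (lp_e2 LP (rg_cospan G)))
    by (intros G; eapply HW; exists _, (rg_cospan G); apply lp_local).
  apply forgetF_lifts.
  - intros G [h0 hs]; simpl in h0, hs.
    destruct (exists_triples_object h0) as [T [t1 [t2 [t3 [td [tc tu]]]]]].
    (* The terms [t1], [t2], [t3] stand for y, w, x; the equalizer imposes [dx = cy]. *)
    destruct (HE _ _ (rg_d G ∘ t3) (rg_c G ∘ t1)) as [Z [k [ke ku]]].
    assert (qe : rg_d G ∘ (t3 ∘ k) = rg_c G ∘ (t1 ∘ k)) by (nrmin ke; exact ke).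
    pose (q := lp_pair LP (S := rg_cospan G) qe).
    assert (q1 : lp_1 LP (rg_cospan G) ∘ q = t3 ∘ k) by apply pair_1.
    assert (q2 : lp_2 LP (rg_cospan G) ∘ q = t1 ∘ k) by apply pair_2.
    assert (de := rg_de G); assert (ce := rg_ce G).
    destruct (lp_local LP (rg_cospan G)) as [pb [h11 [h21 [h12 h22]]]].
    simpl in h11, h21, h12, h22.
    assert (ed : rg_d G ∘ (rg_e G ∘ rg_d G) = rg_d G ∘ id_ (rg_C1 G)) by (rw de; reflexivity).
    assert (ec : rg_c G ∘ id_ (rg_C1 G) = rg_c G ∘ (rg_e G ∘ rg_c G)) by (rw ce; reflexivity).
    (* Both unit inclusions [<1, ed>] and [<ec, 1>] lift with [w = 1]. *)
    destruct (tu _ _ _ _ ed (eq_refl (rg_c G ∘ id_ _))) as [a1 [a11 [a12 a13]]].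
    destruct (tu _ _ _ _ (eq_refl (rg_d G ∘ id_ _)) ec) as [a2 [a21 [a22 a23]]].
    destruct (ku _ a1) as [b1 [kb1 _]].
    { nrm; rewrite a11, a13; now rw ce. }
    destruct (ku _ a2) as [b2 [kb2 _]].
    { nrm; rewrite a21, a23; now rw de. }
    assert (qb1 : q ∘ b1 = lp_e1 LP (rg_cospan G)).
    { apply (pb_joint pb).
      - rw q1; rewrite kb1, h11; exact a13.
      - rw q2; rewrite kb1, h21; exact a11. }
    assert (qb2 : q ∘ b2 = lp_e2 LP (rg_cospan G)).
    { apply (pb_joint pb).
      - rw q1; rewrite kb2, h12; exact a23.
      - rw q2; rewrite kb2, h22; exact a21. }
    assert (epi : IsEpi q).
    { intros V u v e; apply (W G); rewrite <- ?qb1, <- ?qb2, !comp_assoc; now rewrite e. }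
    destruct (hs _ _ q epi (t2 ∘ k) (rg_d G ∘ lp_2 LP (rg_cospan G))
      (rg_c G ∘ lp_1 LP (rg_cospan G))) as [m [[m1 [md mc]] _]].
    { rewrite <- comp_assoc, q2, !comp_assoc; now rewrite td. }
    { rewrite <- comp_assoc, q1, !comp_assoc; now rewrite tc. }
    unshelve eexists {| um_m := m |}; trivial.
    + rewrite <- qb1; rw m1; rewrite kb1; exact a12.
    + rewrite <- qb2; rw m1; rewrite kb2; exact a22.
  - intros G _ s t; apply UMGStr_eq, W; now rewrite ?um_e1, ?um_e2.
  - intros G H _ _ s t h; apply W; unfold rg_lp_map; nrm.
    + rewrite um_e1, (lp_map_e1 LP (S := rg_cospan G) (S' := rg_cospan H)) by apply rh_e.
      rw (um_e1 t); reflexivity.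
    + rewrite um_e2, (lp_map_e2 LP (S := rg_cospan G) (S' := rg_cospan H)) by apply rh_e.
      rw (um_e2 t); reflexivity.
Qed.

(* For [k] the equalizer of [u] and [v], the span [(p2 k, p1 k)] is in [M2], and the
   multiplication of the kite given by the two factorizations of [e1] and [e2] through [k]
   is a section of [k]. *)
Lemma kite_mult_weakly_maltsev :
  HasEqualizers CC -> HasSplitEpiEqualizerKernelPairs CC ->
  HasUniqueKiteMult (@M2 CC) -> WeaklyMaltsevType CC.
Proof.
  intros HE HKP HK A C E p1 e1 p2 e2 [B [S L]] V u v eu ev.
  assert (L' := L); destruct L' as [pb [h11 [h21 [h12 h22]]]].
  destruct (HE _ _ u v) as [D [k [ke ku]]].
  assert (kmono : forall Z (x y : Z ~> D), k ∘ x = k ∘ y -> x = y).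
  { intros Z x y e; destruct (ku Z (k ∘ y)) as [m [_ hm]].
    - rw ke; reflexivity.
    - rewrite <- (hm x e); now apply hm. }
  destruct (ku _ e1 eu) as [al [kal _]].
  destruct (ku _ e2 ev) as [ga [kga _]].
  assert (fr := sc_fr S); assert (gs := sc_gs S).
  assert (hD : M2 (mkSpan (p2 ∘ k) (p1 ∘ k))).
  { split; [split; simpl; apply HKP|].
    - exists V, u, v; split; assumption.
    - now exists e2.
    - exists V, u, v; split; assumption.
    - now exists e1.
    - intros Z W q hq x g0 g1 E0 E1; simpl in *; nrmin E0; nrmin E1.
      (* The pullback yields [n : W ~> E], which factors through [k] since it equalizes [u] and [v]
         after the epimorphism [q]. *)
      destruct (pullback_jointly_strongly_monic pb hq (u := k ∘ x) E1 E0)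
        as [n [[n1 [n2 n3]] _]].
      destruct (ku _ n) as [m [km _]].
      { apply hq; nrm; rewrite n1; now rw ke. }
      exists m; repeat split.
      + apply kmono; rw km; exact n1.
      + rw km; exact n3.
      + rw km; exact n2.
      + intros m' [l1 [l2 l3]]; apply hq, kmono; rewrite l1; rw km; exact n1. }
  destruct (HK _ _ _ _ _ _ _ _ _ L _ _ _ (p2 ∘ k) (p1 ∘ k) hD al ga)
    as [m [[m1 [m2 [md mc]]] _]].
  - apply kmono; rw kal; rw kga; exact (lp_unit L).
  - rw kal; rw kga; rw h22; now rewrite h21.
  - rw kga; rw kal; rw h11; now rewrite h12.
  - nrmin md; nrmin mc.
    assert (km : k ∘ m = id_ E).
    { apply (pb_joint pb); nrm.
      - rewrite mc; rw kal; rw h11; reflexivity.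
      - rewrite md; rw kga; rw h22; reflexivity. }
    rewrite <- (comp_idr u), <- (comp_idr v), <- km; rw ke; now nrm.
Qed.
End WeaklyMaltsev.

Theorem theorem3 (CC : Category) (LP : LocalProducts CC) :
  (* (1) *)
  ((forall i j : CondIndex, Condition LP M0 i <-> Condition LP M0 j) /\
   (NaturallyMaltsevType LP <-> forall i : CondIndex, Condition LP M0 i) /\
   (NaturallyMaltsevType LP ->
      forall BP : BinaryProducts CC, HasTerminal CC ->
      exists p : forall D : CC, cube BP D ~> D, IsNaturalMaltsevOperation p) /\
   (NaturallyMaltsevType LP -> HasSplitMonoPushouts CC ->
      forall (A C E : CC) (p1 : E ~> A) (e1 : A ~> E) (p2 : E ~> C) (e2 : C ~> E),
        IsLocalProduct p1 e1 p2 e2 -> IsLocalCoproduct p1 e1 p2 e2))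
  /\
  (* (2) *)
  ((forall i j : CondIndex, Condition LP M1 i <-> Condition LP M1 j) /\
   (MaltsevType CC <-> forall i : CondIndex, Condition LP M1 i) /\
   ((forall i : CondIndex, Condition LP M1 i) <->
      forall (A C E : CC) (p1 : E ~> A) (e1 : A ~> E) (p2 : E ~> C) (e2 : C ~> E),
        IsLocalProduct p1 e1 p2 e2 -> IsExtremal p1 e1 p2 e2))
  /\
  (* (3) *)
  (HasEqualizers CC -> HasSplitEpiEqualizerKernelPairs CC ->
   (forall i j : CondIndex, Condition LP M2 i <-> Condition LP M2 j) /\
   (WeaklyMaltsevType CC <-> forall i : CondIndex, Condition LP M2 i)).
Proof.
  assert (A0 := M0_admissible LP); assert (A1 := M1_admissible LP).
  assert (A2 := M2_admissible LP).
  assert (N : forall M, Admissible LP M ->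
    HasNaturalPreGrpd M <-> forall i, Condition LP M i).
  { intros M HM; split; intros H.
    - exact (natural_pregrpd_conditions HM H).
    - exact (condition_natural_pregrpd HM (H c1)). }
  assert (K : forall M, Admissible LP M -> HasUniqueKiteMult M <-> HasNaturalPreGrpd M).
  { intros M HM; split.
    - exact (unique_kite_mult_pregrpd HM).
    - exact (natural_pregrpd_kite_mult HM). }
  split; [|split].
  - split; [exact (conditions_equivalent A0)|split; [|split]].
    + rewrite <- (N _ A0); apply naturally_maltsev_natural_pregrpd.
    + rewrite naturally_maltsev_natural_pregrpd; intros H BP.
      now apply naturally_maltsev_operation.
    + rewrite naturally_maltsev_natural_pregrpd, <- (K _ A0).
      apply (local_product_coproduct LP).
  - split; [exact (conditions_equivalent A1)|split].
    + rewrite <- (N _ A1); split.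
      * apply (maltsev_natural_pregrpd LP).
      * apply (natural_pregrpd_maltsev LP).
    + rewrite <- (N _ A1), <- (K _ A1); apply kite_mult_extremal.
  - intros HE HKP; split; [exact (conditions_equivalent A2)|].
    rewrite <- (N _ A2); split; intros H.
    + apply (condition_natural_pregrpd (k := c5) A2).
      exact (restrictF_iso (weakly_maltsev_umg LP HE H)).
    + apply (kite_mult_weakly_maltsev HE HKP), (K _ A2), H.
Qed.
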